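(* For $H\in\mathbb{H}^4(\mathbb{R}^3)$ let $d_2=\operatorname{tr}_{13}H^2$ and $d_3=\operatorname{tr}_{13}H^3$. The following nine polynomial invariants $$I_2=\operatorname{tr}d_2,\quad I_3=\operatorname{tr}d_3,\quad I_4=\operatorname{tr}d_2^2,\quad I_5=\operatorname{tr}(d_2d_3),\quad I_6=\operatorname{tr}d_2^3,$$ $$I_7=\operatorname{tr}(d_2^2d_3),\quad I_8=\operatorname{tr}(d_2d_3^2),\quad I_9=\operatorname{tr}d_3^3,\quad I_{10}=\operatorname{tr}(d_2^2d_3^2)$$ form a minimal integrity basis of the invariant algebra $\mathbb{R}[\mathbb{H}^4(\mathbb{R}^3)]^{\mathrm{O}(3)}$.
   Context: $\mathbb{H}^4(\mathbb{R}^3)$ is the real vector space of harmonic (totally symmetric and traceless) fourth-order tensors on $\mathbb{R}^3$, with components taken in an orthonormal basis (repeated indices summed). $\mathrm{O}(3)$ acts by $(g\star H)_{ijkl}=g_{ip}g_{jq}g_{kr}g_{ls}H_{pqrs}$, and $\mathbb{R}[\mathbb{H}^4(\mathbb{R}^3)]^{\mathrm{O}(3)}$ is the algebra of real polynomial functions on $\mathbb{H}^4(\mathbb{R}^3)$ invariant under this action. $(H^2)_{ijkl}=H_{ijpq}H_{pqkl}$, $(H^3)_{ijkl}=(H^2)_{ijpq}H_{pqkl}$, and $(\operatorname{tr}_{13}T)_{ij}=T_{kikj}$, so $d_2,d_3$ are symmetric second-order tensors; products of second-order tensors are matrix products. An integrity basis of the invariant algebra is a finite set of invariant polynomials $\{P_1,\dots,P_k\}$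 such that every invariant polynomial is a polynomial function of $P_1,\dots,P_k$; it is minimal if no proper subset of it is an integrity basis. *)

(* Defs.v *)
From HB Require Import structures.
From mathcomp Require Import all_boot all_order all_algebra perm.
From mathcomp Require Import reals.
From mathcomp Require Import mpoly.

Set Implicit Arguments.
Unset Strict Implicit.
Unset Printing Implicit Defensive.

Import GRing.Theory.

Local Open Scope ring_scope.

(* Indices run over 'I_3 = {0, 1, 2}; the component T_{ijkl} is
   T [tuple i; j; k; l]. *)
Definition tensor4 (R : realType) : Type := {ffun 4.-tuple 'I_3 -> R}.

Definition permute_idx (s : 'S_4) (t : 4.-tuple 'I_3) : 4.-tuple 'I_3 :=
  [tuple tnth t (s a) | a < 4].

Definition totally_symmetric (R : realType) (T : tensor4 R) : bool :=
  [forall s : 'S_4, forall t, T (permute_idx s t) == T t].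

(* For a totally symmetric tensor all contractions of two indices coincide, so
   it suffices to require that the contraction of the first two vanishes. *)
Definition traceless (R : realType) (T : tensor4 R) : bool :=
  [forall i, forall j, \sum_(k < 3) T [tuple k; k; i; j] == 0].

Definition harmonic (R : realType) (T : tensor4 R) : bool :=
  totally_symmetric T && traceless T.

Definition H4 (R : realType) : Type := {T : tensor4 R | harmonic T}.

Definition O3 (R : realType) : Type := {g : 'M[R]_3 | g *m g^T == 1%:M}.

(* (g * T)_{ijkl} = g_{ip} g_{jq} g_{kr} g_{ls} T_{pqrs}, with t = (i,j,k,l) and
   u = (p,q,r,s). *)
Definition act4 (R : realType) (g : 'M[R]_3) (T : tensor4 R) : tensor4 R :=
  [ffun t => \sum_(u : 4.-tuple 'I_3)
               (\prod_(a < 4) g (tnth t a) (tnth u a)) * T u].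

Lemma sum_tuple4 (V : nmodType) (F : 4.-tuple 'I_3 -> V) :
  \sum_t F t =
  \sum_(i < 3) \sum_(j < 3) \sum_(k < 3) \sum_(l < 3) F [tuple i; j; k; l].
Proof.
rewrite !pair_big /=.
rewrite (reindex (fun p : 'I_3 * 'I_3 * 'I_3 * 'I_3 =>
  [tuple p.1.1.1; p.1.1.2; p.1.2; p.2])) //=.
exists (fun t : 4.-tuple 'I_3 => (t`_0, t`_1, t`_2, t`_3)).
  by move=> [[[i j] k] l] _.
by move=> [[|i [|j [|k [|l [|m s]]]]] //= st] _; apply: val_inj.
Qed.

Lemma act4_symmetric (R : realType) (g : 'M[R]_3) (T : tensor4 R) :
  totally_symmetric T -> totally_symmetric (act4 g T).
Proof.
move=> /forallP symT; apply/forallP => s; apply/forallP => t; apply/eqP.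
rewrite !ffunE (reindex (permute_idx s)) /=; last first.
  exists (permute_idx s^-1%g) => u _; apply: eq_from_tnth => a;
    by rewrite !tnth_mktuple ?permK ?permKV.
apply: eq_bigr => u _; have /forallP /(_ u) /eqP -> := symT s.
congr (_ * _); rewrite [RHS](reindex_inj (@perm_inj _ s)) /=.
by apply: eq_bigr => a _; rewrite !tnth_mktuple.
Qed.

Lemma act4_traceless (R : realType) (g : 'M[R]_3) (T : tensor4 R) :
  g *m g^T == 1%:M -> traceless T -> traceless (act4 g T).
Proof.
move=> /eqP /mulmx1C gTg /forallP trT; apply/forallP => i; apply/forallP => j.
have gE p q : \sum_k g k p * g k q = (p == q)%:R.
  have /matrixP /(_ p q) := gTg; rewrite !mxE => <-.
  by apply: eq_bigr => k _; rewrite !mxE.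
apply/eqP; under eq_bigr => k _ do rewrite ffunE sum_tuple4.
rewrite exchange_big /=.
under eq_bigr => p _ do rewrite exchange_big /=.
transitivity (\sum_(p < 3) \sum_(q < 3) \sum_(r < 3) \sum_(s < 3)
  (p == q)%:R * (g i r * g j s * T [tuple p; q; r; s])).
  apply: eq_bigr => p _; apply: eq_bigr => q _.
  rewrite exchange_big /=; apply: eq_bigr => r _.
  rewrite exchange_big /=; apply: eq_bigr => s _.
  rewrite -gE mulr_suml; apply: eq_bigr => k _.
  by rewrite !big_ord_recl big_ord0 !(tnth_nth 0) /= mulr1 !mulrA.
transitivity (\sum_(r < 3) \sum_(s < 3)
  g i r * g j s * \sum_(p < 3) T [tuple p; p; r; s]).
  transitivity (\sum_(p < 3) \sum_(r < 3) \sum_(s < 3)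
    g i r * g j s * T [tuple p; p; r; s]).
    apply: eq_bigr => p _; rewrite (bigD1 p) //= [X in _ + X]big1 ?addr0.
      by do 2 (apply: eq_bigr => ? _); rewrite eqxx mul1r.
    move=> q /negPf qp; do 2 (apply: big1 => ? _).
    by rewrite eq_sym qp mul0r.
  rewrite exchange_big /=; apply: eq_bigr => r _.
  rewrite exchange_big /=; apply: eq_bigr => s _.
  by rewrite mulr_sumr.
apply: big1 => r _; apply: big1 => s _.
by have /forallP /(_ s) /eqP -> := trT r; rewrite mulr0.
Qed.

Lemma act4_harmonic (R : realType) (g : O3 R) (H : H4 R) :
  harmonic (act4 (val g) (val H)).
Proof.
have /andP[symH trH] := valP H; apply/andP; split.
  exact: act4_symmetric.
exact: act4_traceless (valP g) trH.
Qed.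

Definition actH (R : realType) (g : O3 R) (H : H4 R) : H4 R :=
  exist _ (act4 (val g) (val H)) (act4_harmonic g H).

(* A polynomial function on H4 is the restriction of a polynomial in the 81
   components T_{ijkl}, whose variables are numbered by enum_val. *)
Definition polynomial_function (R : realType) (f : H4 R -> R) : Prop :=
  exists p : {mpoly R[#|{: 4.-tuple 'I_3}|]},
    forall H, f H = p.@[fun a => val H (enum_val a)].

Definition O3_invariant (R : realType) (f : H4 R -> R) : Prop :=
  forall g H, f (actH g H) = f H.

Definition invariant_polynomial (R : realType) (f : H4 R -> R) : Prop :=
  polynomial_function f /\ O3_invariant f.

Definition integrity_basis (R : realType) (n : nat) (P : 'I_n -> H4 R -> R) :
    Prop :=
  (forall i, invariant_polynomial (P i)) /\
  (forall f, invariant_polynomial f ->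
     exists q : {mpoly R[n]}, forall H, f H = q.@[fun i => P i H]).

(* Subsets are taken on indices, so minimality also forces the P i to be
   pairwise distinct. *)
Definition minimal_integrity_basis (R : realType) (n : nat)
    (P : 'I_n -> H4 R -> R) : Prop :=
  integrity_basis P /\
  (forall J : {set 'I_n}, J \proper [set: 'I_n] ->
     ~ integrity_basis (fun a : 'I_#|J| => P (enum_val a))).

(* (T U)_{ijkl} = T_{ijpq} U_{pqkl}, with t = (i,j,k,l). *)
Definition mul4 (R : realType) (T U : tensor4 R) : tensor4 R :=
  [ffun t : 4.-tuple 'I_3 => \sum_(p < 3) \sum_(q < 3)
     T [tuple t`_0; t`_1; p; q] * U [tuple p; q; t`_2; t`_3]].

Definition tr13 (R : realType) (T : tensor4 R) : 'M[R]_3 :=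
  \matrix_(i < 3, j < 3) \sum_(k < 3) T [tuple k; i; k; j].

Definition d2 (R : realType) (H : H4 R) : 'M[R]_3 :=
  tr13 (mul4 (val H) (val H)).

Definition d3 (R : realType) (H : H4 R) : 'M[R]_3 :=
  tr13 (mul4 (mul4 (val H) (val H)) (val H)).

Definition I2 (R : realType) (H : H4 R) : R := \tr (d2 H).
Definition I3 (R : realType) (H : H4 R) : R := \tr (d3 H).
Definition I4 (R : realType) (H : H4 R) : R := \tr (d2 H ^+ 2).
Definition I5 (R : realType) (H : H4 R) : R := \tr (d2 H *m d3 H).
Definition I6 (R : realType) (H : H4 R) : R := \tr (d2 H ^+ 3).
Definition I7 (R : realType) (H : H4 R) : R := \tr (d2 H ^+ 2 *m d3 H).
Definition I8 (R : realType) (H : H4 R) : R := \tr (d2 H *m d3 H ^+ 2).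
Definition I9 (R : realType) (H : H4 R) : R := \tr (d3 H ^+ 3).
Definition I10 (R : realType) (H : H4 R) : R := \tr (d2 H ^+ 2 *m d3 H ^+ 2).

(* Main.v *)
(** Upper bound.  Over the complex numbers the invariants of degree [d] are the
    vectors of weight 0 in the polynomials of degree [d] on the nine-dimensional
    irreducible representation of sl2 that are killed by the raising operator
    [E].  As [E] maps weight 0 onto weight 1, they span a space of dimension
    [N0 d - N1 d], where [Nw d] counts the monomials of degree [d] and weight
    [w]; this number is the coefficient of [t^d] in
    [(1 + t^8 + t^9 + t^10 + t^18) / prod_(2 <= i <= 7) (1 - t^i)].

    Lower bound.  The products of monomials in [I2, ..., I7] with one of [1],
    [I8], [I9], [I10], [I9^2] are linearly independent, and that number of them
    has degree [d].  It suffices to check independence modulo 7, where there are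
    five points with the same values of [I2, ..., I7], at which these six have
    independent differentials, and at which the values of the five module
    generators form an invertible matrix: the lowest order part of a relation
    around that common value would have to vanish.

    Hence these products are a basis of the invariants, and minimality follows
    since every monomial of weighted degree at most 10 in the nine invariants is
    one of them. *)

From HB Require Import structures.
From mathcomp Require Import all_boot all_order all_algebra perm.
From mathcomp Require Import reals complex mpoly.
From mathcomp Require Import zify ring.
Require Import Defs.

Set Implicit Arguments.
Unset Strict Implicit.
Unset Printing Implicit Defensive.

Import Order.TTheory GRing.Theory Num.Theory.

Local Open Scope ring_scope.

(** * Counting monomials by degree and weight *)

(** Invariance enters the upper bound through its derivative. Evaluating a homogeneous invariant
    along rotations in their rational parametrization gives an identity between polynomials in one
    variable, and its first order term says that three derivations annihilate the invariant. Over
    the complex numbers these derivations combine into the operators of the sl2 action on binary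
    octavics. The size of the invariants shapes the lower bound. They are never expanded in their
    nine variables: they are programs over an arbitrary arithmetic, run on first order jets with
    coefficients modulo 7. The conclusion returns to characteristic zero because the power products
    have integer coefficients, so that a determinant that is nonzero modulo 7 is a nonzero
    integer. *)

Fixpoint dot_nat (ds : seq int) (s : seq nat) : int :=
  if ds is i :: ds' then
    if s is k :: s' then k%:Z * i + dot_nat ds' s' else 0
  else 0.

(** Exponent vectors of degree [d] and weight [w] in variables of bidegrees [ds]. Both gradings are
    integers, so that shifts never truncate and the recurrences hold for all [d] and [w]. The range
    of [k] suffices when every degree is positive. *)
Fixpoint mons (ds : seq (int * int)) (d w : int) : seq (seq nat) :=
  if ds is (i, j) :: ds' then
    flatten [seq [seq k :: s | s <- mons ds' (d - k%:Z * i) (w - k%:Z * j)]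
            | k <- iota 0 `|d|%N.+1]
  else if (d == 0) && (w == 0) then [:: [::]] else [::].

Definition cnt ds d w : int := (size (mons ds d w))%:Z.

Definition graded (ds : seq (int * int)) := all (fun x => 0 < x.1) ds.

Lemma mons_cons i j ds d w :
  mons ((i, j) :: ds) d w =
  flatten [seq [seq k :: s | s <- mons ds (d - k%:Z * i) (w - k%:Z * j)]
            | k <- iota 0 `|d|%N.+1].
Proof. by []. Qed.

Lemma flatten_nil (T : Type) (f : nat -> seq T) r :
  (forall k, f k = [::]) -> flatten [seq f k | k <- r] = [::].
Proof. by move=> f0; elim: r => //= k r ->; rewrite f0. Qed.

Lemma mons_neg ds d w : graded ds -> d < 0 -> mons ds d w = [::].
Proof.
elim: ds d w => [|[i j] ds IH] d w; first by rewrite /=; case: eqP => //; lia.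
move=> /andP[i0 gds] d0; have {}i0 : 0 < i := i0.
rewrite mons_cons; apply: flatten_nil => k; rewrite IH //; nia.
Qed.

Lemma mem_mons ds d w s : graded ds ->
  (s \in mons ds d w) = [&& size s == size ds,
    dot_nat (map fst ds) s == d & dot_nat (map snd ds) s == w].
Proof.
elim: ds d w s => [|[i j] ds IH] d w s.
  rewrite /= (eq_sym 0 d) (eq_sym 0 w) => _.
  by case: s => [|k s]; case: ifP; rewrite ?inE.
move=> /andP[i0 gds]; have {}i0 : 0 < i := i0.
rewrite mons_cons; apply/flatten_mapP/idP => [[k kd /mapP[s' s'P ->]]|].
  move: s'P; rewrite IH //= => /and3P[/eqP -> /eqP -> /eqP ->].
  by rewrite !(addrC (k%:Z * _)) !subrK !eqxx.
case: s => // k s /and3P[/eqP[ss] /eqP sd /eqP sw]; rewrite /= in sd sw.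
have sP : s \in mons ds (d - k%:Z * i) (w - k%:Z * j).
  by rewrite IH // ss eqxx -sd -sw !(addrC (k%:Z * _)) !addrK !eqxx.
exists k; last by apply/mapP; exists s.
rewrite mem_iota /=; case: (ltP (d - k%:Z * i) 0) => [d0|]; last by nia.
by rewrite mons_neg in sP.
Qed.

Lemma uniq_mons ds d w : uniq (mons ds d w).
Proof.
elim: ds d w => [|[i j] ds IH] d w; first by rewrite /=; case: ifP.
rewrite mons_cons; have := iota_uniq 0 `|d|%N.+1;
  elim: (iota _ _) => //= k s IHs /andP[ks us].
rewrite cat_uniq IHs // andbT map_inj_uniq ?IH; last by move=> ? ? [].
apply/hasPn => x /flatten_mapP[l ls /mapP[y _ ->]].
by apply/mapP => -[z _ [lk _]]; rewrite -lk ls in ks.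
Qed.

(** Exponents [k] beyond the degree contribute nothing, so any [n > d] is a valid range; this
    freedom aligns the ranges of two expansions. *)
Lemma cntE n i j ds d w : 0 < i -> graded ds -> d < n%:Z ->
  cnt ((i, j) :: ds) d w = \sum_(k < n) cnt ds (d - k%:Z * i) (w - k%:Z * j).
Proof.
move=> i0 gds dn; rewrite /cnt mons_cons size_flatten /shape -map_comp sumnE big_map.
rewrite -[iota _ _]/(index_iota 0 `|d|.+1) big_mkord.
under eq_bigr => k _ do rewrite /= size_map.
have [d0|d0] := ltP d 0.
  rewrite !big1 // => k _; rewrite mons_neg //; nia.
have dn' : (`|d|.+1 <= n)%N by lia.
rewrite -(big_mkord xpredT (fun k => size (mons ds (d - k%:Z * i) (w - k%:Z * j)))).
rewrite -(big_mkord xpredT (fun k => (size (mons ds (d - k%:Z * i) (w - k%:Z * j)))%:Z)).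
rewrite (@big_cat_nat _ _ _ _ _ _ _ _ _ dn') //= [X in _ = _
  + X]big_nat_cond [X in _ = _ + X]big1; last first.
  by move=> k /andP[/andP[k1 k2] _]; rewrite mons_neg //; nia.
by rewrite addr0 (big_morph _ PoszD (erefl _)).
Qed.

(** Coefficient form of the fact that multiplying a generating series by [1 - t^i q^j] removes one
    variable of bidegree [(i, j)]: only the term [k = 0] survives the difference. *)
Lemma cnt_rec i j ds d w : 0 < i -> graded ds ->
  cnt ((i, j) :: ds) d w - cnt ((i, j) :: ds) (d - i) (w - j) = cnt ds d w.
Proof.
move=> i0 gds; rewrite (@cntE `|d|.+2 i j ds) // ?(@cntE `|d|.+1 i j ds) //; try lia.
rewrite big_ord_recl /= !mul0r !subr0 -addrA [X in _ + X](_ : _ = 0) ?addr0 //.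
apply/eqP; rewrite subr_eq0; apply/eqP; apply: eq_bigr => k _.
by congr cnt; rewrite /bump /= PoszD; ring.
Qed.

Lemma cnt_swap a b ds d w : 0 < a.1 -> 0 < b.1 -> graded ds ->
  cnt (a :: b :: ds) d w = cnt (b :: a :: ds) d w.
Proof.
case: a b => [a a'] [b b'] /= a0 b0 gds.
have low (k : nat) e : 0 < e -> d - k%:Z * e < `|d|.+1%:Z by nia.
rewrite !(@cntE `|d|.+1) //= ?a0 ?b0 //; try lia.
transitivity (\sum_(k < `|d|.+1) \sum_(l < `|d|.+1)
   cnt ds (d - k%:Z * a - l%:Z * b) (w - k%:Z * a' - l%:Z * b')).
  by apply: eq_bigr => k _; rewrite (@cntE `|d|.+1) ?low //.
rewrite exchange_big /=; apply: eq_bigr => k _.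
rewrite (@cntE `|d|.+1) ?low //.
by apply: eq_bigr => l _; congr cnt; ring.
Qed.

Lemma graded_cat s1 s2 : graded (s1 ++ s2) = graded s1 && graded s2.
Proof. exact: all_cat. Qed.

Lemma cnt_move a s1 s2 d w : 0 < a.1 -> graded s1 -> graded s2 ->
  cnt (s1 ++ a :: s2) d w = cnt (a :: s1 ++ s2) d w.
Proof.
move=> a0; elim: s1 d w => //= b s1 IH d w /andP[b0 g1] g2.
have gs : graded (s1 ++ s2) by rewrite graded_cat g1.
have ga : graded (a :: s1 ++ s2) by rewrite /= a0.
have gm : graded (s1 ++ a :: s2) by rewrite graded_cat g1 /= a0.
rewrite cnt_swap //; case: b b0 => i j /= i0.
rewrite (@cntE `|d|.+1 _ _ (s1 ++ a :: s2)) // 1?(@cntE `|d|.+1 _ _ (a :: _)) //; try lia.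
by apply: eq_bigr => k _; rewrite IH.
Qed.

(** Factors are cancelled at the head of the list; this brings the negative weights there. *)
Lemma cnt_catCA s1 s2 s3 d w : graded s1 -> graded s2 -> graded s3 ->
  cnt (s1 ++ s2 ++ s3) d w = cnt (s2 ++ s1 ++ s3) d w.
Proof.
move=> + g2 g3; elim: s1 d w => //= a s1 IH d w /andP[a0 g1].
rewrite cnt_move ?graded_cat ?g1 //; case: a a0 => i j /= i0.
rewrite (@cntE `|d|.+1) ?graded_cat ?g1 ?g2 //; last by lia.
rewrite (@cntE `|d|.+1) ?graded_cat ?g1 ?g2 //; last by lia.
by apply: eq_bigr => k _; rewrite IH.
Qed.

Lemma mons_weight_lt0 ds d w : all (fun x => 0 <= x.2) ds -> w < 0 ->
  mons ds d w = [::].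
Proof.
elim: ds d w => [|[i j] ds IH] d w.
  by rewrite /=; case: (w =P 0); rewrite ?andbF //; lia.
move=> /andP[j0 gds] w0; rewrite /= in j0.
rewrite mons_cons; apply: flatten_nil => k; rewrite IH //; nia.
Qed.

Lemma mons_weight_gt0 ds d w : all (fun x => x.2 <= 0) ds -> 0 < w ->
  mons ds d w = [::].
Proof.
elim: ds d w => [|[i j] ds IH] d w.
  by rewrite /=; case: (w =P 0); rewrite ?andbF //; lia.
move=> /andP[j0 gds] w0; rewrite /= in j0.
rewrite mons_cons; apply: flatten_nil => k; rewrite IH //; nia.
Qed.

(* A Laurent polynomial [sum c t^i q^j], given by the list of the [(i, j, c)],
   acts on functions of the degree and the weight by shifting them. *)
Definition laurent := seq (int * int * int).

Definition act (l : laurent) (f : int -> int -> int) (d w : int) : int :=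
  foldr (fun x a => x.2 * f (d - x.1.1) (w - x.1.2) + a) 0 l.

Definition mul_laurent (a b : laurent) : laurent :=
  [seq (x.1.1 + y.1.1, x.1.2 + y.1.2, x.2 * y.2) | x <- a, y <- b].

Fixpoint add_term (x : int * int * int) (l : laurent) : laurent :=
  if l is y :: l' then
    if x.1 == y.1 then (y.1, x.2 + y.2) :: l' else y :: add_term x l'
  else [:: x].

Definition null_laurent (l : laurent) : bool :=
  all (fun x => x.2 == 0) (foldr add_term [::] l).

Lemma act1 x f d w : act [:: x] f d w = x.2 * f (d - x.1.1) (w - x.1.2).
Proof. exact: addr0. Qed.

Lemma act_one f d w : act [:: (0, 0, 1)] f d w = f d w.
Proof. by rewrite act1 mul1r !subr0. Qed.

Lemma act_cat a b f d w : act (a ++ b) f d w = act a f d w + act b f d w.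
Proof. by elim: a => [|x a /= ->]; rewrite ?add0r //= addrA. Qed.

Lemma eq_act l f g : (forall d w, f d w = g d w) ->
  forall d w, act l f d w = act l g d w.
Proof. by move=> fg d w; elim: l => //= x l ->; rewrite fg. Qed.

Lemma act_mul a b f d w : act (mul_laurent a b) f d w = act a (act b f) d w.
Proof.
rewrite /mul_laurent; elim: a => //= x a IH; rewrite act_cat IH; congr (_ + _).
elim: b {IH} => /= [|y b ->]; first by rewrite mulr0.
by rewrite mulrDr mulrA !opprD !addrA.
Qed.

Lemma act_null l f d w : null_laurent l -> act l f d w = 0.
Proof.
have addE x a : act (add_term x a) f d w = act (x :: a) f d w.
  elim: a => //= y a IH; case: eqP => [xy|_] /=; last by rewrite IH /=; ring.
  by rewrite xy; ring.
have <- : act (foldr add_term [::] l) f d w = act l f d w.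
  by elim: l => //= x l IH; rewrite addE /= IH.
rewrite /null_laurent; elim: (foldr _ _ _) => //= x a IH /andP[/eqP -> /IH ->].
by rewrite mul0r.
Qed.

Lemma act_eq a b f d w :
  null_laurent (a ++ mul_laurent [:: (0, 0, -1)] b) ->
  act a f d w = act b f d w.
Proof.
move=> /(act_null f d w); rewrite act_cat act_mul act1 !subr0 mulN1r.
by move/eqP; rewrite subr_eq0 => /eqP.
Qed.

Definition factor (i j : int) : laurent := [:: (0, 0, 1); (i, j, -1)].

Lemma act_factorE i j f d w :
  act (factor i j) f d w = f d w - f (d - i) (w - j).
Proof. by rewrite (act_cat [:: _]) act_one act1 mulN1r. Qed.

Definition factors (ds : seq (int * int)) : laurent :=
  foldr (fun x a => mul_laurent a (factor x.1 x.2)) [:: (0, 0, 1)] ds.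

Lemma act_factor i j ds d w : 0 < i -> graded ds ->
  act (factor i j) (cnt ((i, j) :: ds)) d w = cnt ds d w.
Proof. by move=> i0 gds; rewrite act_factorE cnt_rec. Qed.

Lemma act_factors ds ds' d w : graded ds -> graded ds' ->
  act (factors ds) (cnt (ds ++ ds')) d w = cnt ds' d w.
Proof.
move=> + gds'; elim: ds d w => [|[i j] ds IH] d w; first by rewrite act_one.
move=> /andP[i0 gds]; rewrite act_mul -IH //; apply: eq_act => {}d {}w.
by apply: act_factor; rewrite // graded_cat; apply/andP.
Qed.

(** A factor [1 - t^i] with [i > 0] can be divided out of a series known in negative degrees, since
    the coefficients are recovered by induction on the degree. As the factors have weight zero, the
    recursion stays at weight 0. *)
Lemma act_factors_inj ds f g : graded ds ->
  (forall d w, d < 0 -> f d w = g d w) ->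
  (forall d, act (factors ds) f d 0 = act (factors ds) g d 0) ->
  all (fun x => x.2 == 0) ds -> forall d, f d 0 = g d 0.
Proof.
elim: ds f g => [|[i j] ds IH] f g gds f0 fg ds0 d.
  by have := fg d; rewrite !act_one.
case/andP: gds => i0 gds; case/andP: ds0 => /eqP j0 ds0.
rewrite /= in i0 j0; subst j.
have {}fg e : act (factor i 0) f e 0 = act (factor i 0) g e 0.
  apply: (IH (act (factor i 0) f) (act (factor i 0) g)) => // [{}e w e0|{}e].
    by rewrite !act_factorE !f0 //; lia.
  by rewrite -!act_mul.
have [n] := ubnP `|d|%N; elim: n d => // n IHn d dn.
have [d0|d0] := ltP d 0; first exact: f0.
have := fg d; rewrite !act_factorE !subr0.
have -> : f (d - i) 0 = g (d - i) 0.
  by have [?|?] := ltP (d - i) 0; [apply: f0 | apply: IHn; lia].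
by move/addIr.
Qed.

(** * The Hilbert series of the invariants of binary octavics *)

Definition octavic_weights : seq (int * int) :=
  [:: (1, 1); (1, 2); (1, 3); (1, 4); (1, -1); (1, -2); (1, -3); (1, -4); (1, 0)]%Z.

Definition parameter_degrees : seq (int * int) :=
  [:: (2, 0); (3, 0); (4, 0); (5, 0); (6, 0); (7, 0)]%Z.

Definition module_degrees : seq nat := [:: 0; 8; 9; 10; 18]%N.

Definition count_standard (d : int) : int :=
  \sum_(b <- module_degrees) cnt parameter_degrees (d - b%:Z) 0.

Definition pos_weights : seq (int * int) := [:: (1, 1); (1, 2); (1, 3); (1, 4)]%Z.
Definition neg_weights : seq (int * int) :=
  [:: (1, -1); (1, -2); (1, -3); (1, -4)]%Z.

(* With [P], [P'] and [D] the products of the [1 - t q^j] over [1 <= j <= 4],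
   of the [1 - t q^-j], and of the [1 - t^i] over [2 <= i <= 7], the two lists
   below are [P] and [P'] times the parts of positive and of nonpositive
   weight of [D (1 - 1/q) / (P P')]. *)
Definition pos_part : laurent :=
  [:: (1, 4, 1); (2, 2, 1); (2, 5, -1); (2, 7, -1); (3, 4, -1); (3, 7, 1); (3,
   9, 1); (4, 2, 1); (4, 5, 1); (4, 10, -1); (5, 1, 1); (5, 4, -1); (5, 6,
   -1); (5, 9, -1); (5, 10, 1); (6, 2, -1); (6, 5, -1); (6, 7, 1); (7, 1, 1);
   (7, 3, 1); (8, 2, -1); (8, 3, -1); (8, 4, -1); (8, 5, -1); (8, 6, -1); (9,
   1, 1); (9, 2, -1); (9, 3, 1); (9, 4, 1); (9, 6, 1); (9, 8, 1); (10, 1,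
   -1); (10, 3, -1); (10, 4, -1); (10, 5, -1); (10, 7, -2); (11, 2, 1); (11,
   4, 1); (11, 6, 1); (11, 8, 1); (11, 9, 1); (12, 1, -1); (12, 3, -1); (12,
   4, -1); (12, 5, -1); (12, 7, -1); (12, 9, 1); (12, 10, -1); (13, 2, 1);
   (13, 5, 2); (13, 6, 1); (13, 7, 1); (13, 8, 1); (14, 1, -1); (14, 3, -1);
   (14, 6, -1); (14, 7, 1); (14, 8, -1); (14, 9, -1); (15, 3, 1); (15, 4, 1);
   (15, 5, 1); (15, 6, 1); (15, 7, 1); (15, 9, -1); (15, 10, 1); (16, 6, -1);
   (16, 8, -1); (17, 2, -1); (17, 4, 1); (17, 7, 1); (18, 3, 1); (18, 5, 1);
   (18, 8, -1); (19, 7, -1); (20, 7, -1); (21, 9, 1); (22, 10, -1); (23, 9,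
   -1); (23, 10, 1)]%Z.

Definition neg_part : laurent :=
  [:: (0, -1, -1); (0, 0, 1); (1, 0, -1); (2, -1, 1); (3, -3, -1); (4, -3, -1);
   (5, -7, 1); (5, -5, 1); (5, -2, -1); (6, -8, -1); (6, -6, 1); (6, -3, 1);
   (7, -4, -1); (7, -2, -1); (8, -7, 1); (8, -6, 1); (8, -5, 1); (8, -4, 1);
   (8, -3, 1); (8, -1, -1); (8, 0, 1); (9, -9, -1); (9, -7, -1); (9, -4, -1);
   (9, -3, 1); (9, -2, -1); (9, -1, -1); (10, -8, 1); (10, -5, 2); (10, -4,
   1); (10, -3, 1); (10, -2, 1); (11, -9, -1); (11, -7, -1); (11, -6, -1);
   (11, -5, -1); (11, -3, -1); (11, -1, 1); (11, 0, -1); (12, -8, 1); (12,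
   -6, 1); (12, -4, 1); (12, -2, 1); (12, -1, 1); (13, -9, -1); (13, -7, -1);
   (13, -6, -1); (13, -5, -1); (13, -3, -2); (14, -9, 1); (14, -8, -1); (14,
   -7, 1); (14, -6, 1); (14, -4, 1); (14, -2, 1); (15, -8, -1); (15, -7, -1);
   (15, -6, -1); (15, -5, -1); (15, -4, -1); (16, -9, 1); (16, -7, 1); (17,
   -8, -1); (17, -5, -1); (17, -3, 1); (18, -9, 1); (18, -6, -1); (18, -4,
   -1); (18, -1, -1); (18, 0, 1); (19, -8, 1); (19, -5, 1); (19, 0, -1); (20,
   -6, -1); (20, -3, 1); (20, -1, 1); (21, -8, 1); (21, -5, -1); (21, -3,
   -1); (22, -6, 1)]%Z.

Lemma partial_fractions :
  null_laurent (mul_laurent (factors parameter_degrees) (factor 0 (-1)) ++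
    mul_laurent [:: (0, 0, -1)]
      (mul_laurent pos_part (factors neg_weights) ++
       mul_laurent neg_part (factors pos_weights))).
Proof. by vm_compute. Qed.

Definition weight_zero_part (l : laurent) : laurent :=
  [seq x <- l | x.1.2 == 0].

Lemma act_weight_zero_part l f d : all (fun x => x.1.2 <= 0) l ->
  (forall d w, 0 < w -> f d w = 0) ->
  act l f d 0 = act (weight_zero_part l) f d 0.
Proof.
move=> + f0; elim: l => //= x l IH /andP[x0 /IH ->].
case: eqP => [//|x1] /=; rewrite f0 ?mulr0 ?add0r //; lia.
Qed.

Definition module_laurent : laurent :=
  [seq (b%:Z, 0, 1) | b <- module_degrees].

(** Among variables of nonpositive weight, one of negative weight cannot occur in a monomial of
    weight 0. *)
Lemma cnt_neg_weights d : cnt (neg_weights ++ [:: (1, 0)]) d 0 = cnt [:: (1, 0)] d 0.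
Proof.
have step j ds e : all (fun x => x.2 <= 0) ds -> graded ds -> j < 0 ->
    cnt ((1, j) :: ds) e 0 = cnt ds e 0.
  move=> ds0 gds j0; have := @cnt_rec 1 j ds e 0 isT gds.
  rewrite [X in _ - X](_ : _ = 0); first by rewrite subr0.
  rewrite /cnt mons_weight_gt0 //=; first by rewrite (ltW j0).
  by rewrite sub0r oppr_gt0.
by do 4 rewrite step //.
Qed.

(** Both sides are multiplied by the product of the [1 - t^i]. By [partial_fractions] the left side
    splits in two: one part has only positive weights and is invisible at weight 0; in the other
    only the weight zero terms of [neg_part] count. These terms are [module_laurent] times [1 - t],
    and [1 - t] cancels the variable of weight 0. *)
Lemma count_octavic d :
  cnt octavic_weights d 0 - cnt octavic_weights d 1 = count_standard d.
Proof.
pose f := cnt octavic_weights.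
pose g e w := act module_laurent (cnt parameter_degrees) e w.
have gE e : g e 0 = count_standard e.
  rewrite /g /count_standard /module_laurent /act; elim: module_degrees => /= [|b s ->].
    by rewrite big_nil.
  by rewrite big_cons mul1r subr0.
rewrite -gE; transitivity (act (factor 0 (-1)) f d 0).
  by rewrite act_factorE subr0 sub0r opprK.
pose h := act (factor 0 (-1)) f.
apply: (@act_factors_inj parameter_degrees h g _ _ _ _ d) => // [e w e0|e].
  rewrite /h act_factorE subr0 /f /cnt !mons_neg //.
  have: all (fun x => 0 <= x.1.1) module_laurent by [].
  rewrite /g; elim: module_laurent => //= x l IH /andP[x0 /IH <-].
  by rewrite /cnt mons_neg ?mulr0 //; lia.
rewrite -act_mul (act_eq f e 0 partial_fractions) act_cat.
rewrite (act_mul pos_part) (act_mul neg_part).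
have fneg a b : act (factors neg_weights) f a b = cnt (pos_weights ++ [:: (1, 0)]) a b.
  rewrite -(@act_factors neg_weights (pos_weights ++ [:: (1, 0)]) a b isT isT).
  by apply: eq_act => {}a {}b; apply: (@cnt_catCA pos_weights neg_weights [:: (1, 0)]).
have fpos a b : act (factors pos_weights) f a b = cnt (neg_weights ++ [:: (1, 0)]) a b.
  exact: (@act_factors pos_weights (neg_weights ++ [:: (1, 0)]) a b isT isT).
rewrite (eq_act _ fneg) (eq_act _ fpos) [X in X + _](_ : _ = 0); last first.
  have: all (fun x => 0 < x.1.2) pos_part by vm_compute.
  elim: pos_part => //= x l IH /andP[x0 /IH ->].
  by rewrite /cnt mons_weight_lt0 ?mulr0 //; lia.
rewrite add0r act_weight_zero_part; first last.
- by move=> a b b0; rewrite /cnt mons_weight_gt0.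
- by vm_compute.
have -> : act (factors parameter_degrees) g e 0 = act module_laurent (cnt [::]) e 0.
  rewrite -[LHS](act_mul (factors parameter_degrees) module_laurent).
  rewrite (act_eq (b := mul_laurent module_laurent (factors parameter_degrees))).
    rewrite act_mul; apply: eq_act => a b.
    exact: (@act_factors parameter_degrees [::] a b isT isT).
  by vm_compute.
have -> : act (weight_zero_part neg_part) (cnt (neg_weights ++ [:: (1, 0)])) e 0 =
   act (weight_zero_part neg_part) (cnt [:: (1, 0)]) e 0.
  have: all (fun x => x.1.2 == 0) (weight_zero_part neg_part) by vm_compute.
  elim: (weight_zero_part _) => //= x l IH /andP[/eqP -> /IH ->].
  by rewrite subr0 cnt_neg_weights.
rewrite (act_eq (b := mul_laurent module_laurent (factor 1 0))); last by vm_compute.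
by rewrite act_mul; apply: eq_act => a b; apply: (@act_factor 1 0 [::] a b).
Qed.

(** * Invariants as programs over an arbitrary arithmetic *)

(** Operations without laws: the same program runs on polynomials and, inside [vm_compute], on jets
    represented by natural numbers, which form no ring. *)
Record arith (T : Type) := Arith {
  azero : T; aadd : T -> T -> T; aopp : T -> T; amul : T -> T -> T }.

Section Program.
Context (T : Type) (A : arith T).

Definition sum3 (f : nat -> T) : T :=
  aadd A (f 0%N) (aadd A (f 1%N) (aadd A (f 2%N) (azero A))).

(* Extensionally [f] on [{0, 1, 2}], but evaluated only once. *)
Definition store (f : nat -> nat -> T) : nat -> nat -> T :=
  let s := [seq [seq f i j | j <- iota 0 3] | i <- iota 0 3] in
  fun i j => nth (azero A) (nth [::] s i) j.

(* The component of a harmonic tensor on [x^(4-b-c) y^b z^c] in terms of the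
   nine components with [c <= 1]; tracelessness gives those with [c >= 2]. *)
Definition component (x : nat -> T) (b c : nat) : T :=
  match c with
  | 0 => x b
  | 1 => x (5 + b)%N
  | 2 => aopp A (aadd A (x b) (x (b + 2)%N))
  | 3 => aopp A (aadd A (x (5 + b)%N) (x (7 + b)%N))
  | _ => aadd A (aadd A (x 0%N) (x 2%N)) (aadd A (x 2%N) (x 4%N))
  end.

Definition tensor_of (x : nat -> T) (i j k l : nat) : T :=
  component x (count_mem 1%N [:: i; j; k; l]) (count_mem 2%N [:: i; j; k; l]).

Definition square_of (x : nat -> T) (i j k l : nat) : T :=
  sum3 (fun p => sum3 (fun q =>
    amul A (tensor_of x i j p q) (tensor_of x p q k l))).

Definition d2_of (x : nat -> T) : nat -> nat -> T :=
  store (fun i j => sum3 (fun k => square_of x k i k j)).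

Definition d3_of (x : nat -> T) : nat -> nat -> T :=
  store (fun i j => sum3 (fun k => sum3 (fun p => sum3 (fun q =>
    amul A (square_of x k i p q) (tensor_of x p q k j))))).

Definition mul3 (a b : nat -> nat -> T) : nat -> nat -> T :=
  store (fun i j => sum3 (fun k => amul A (a i k) (b k j))).

Definition trace3 (a : nat -> nat -> T) : T := sum3 (fun i => a i i).

Definition invariants (x : nat -> T) : seq T :=
  let a := d2_of x in let b := d3_of x in
  let aa := mul3 a a in let bb := mul3 b b in
  [:: trace3 a; trace3 b; trace3 aa; trace3 (mul3 a b); trace3 (mul3 a aa);
      trace3 (mul3 aa b); trace3 (mul3 a bb); trace3 (mul3 b bb);
      trace3 (mul3 aa bb)].

End Program.

Section Parametricity.
Context (T U : Type) (A : arith T) (B : arith U) (rel : T -> U -> Prop).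
Hypothesis rel0 : rel (azero A) (azero B).
Hypothesis relD : forall a b a' b',
  rel a b -> rel a' b' -> rel (aadd A a a') (aadd B b b').
Hypothesis relN : forall a b, rel a b -> rel (aopp A a) (aopp B b).
Hypothesis relM : forall a b a' b',
  rel a b -> rel a' b' -> rel (amul A a a') (amul B b b').

Let relS f g : (forall i, rel (f i) (g i)) -> rel (sum3 A f) (sum3 B g).
Proof. by move=> fg; do 3 apply: relD => //. Qed.

Let rel_store f g : (forall i j, rel (f i j) (g i j)) ->
  forall i j, rel (store A f i j) (store B g i j).
Proof.
by move=> fg [|[|[|i]]] [|[|[|j]]]; rewrite /store /= ?nth_nil.
Qed.

(** Used for three relations: equality, the graph of a ring morphism, and having a given first order
    jet. *)
Lemma invariants_rel x y : (forall i, rel (x i) (y i)) ->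
  forall k, rel (nth (azero A) (invariants A x) k)
                (nth (azero B) (invariants B y) k).
Proof.
move=> xy.
have relT i j k l : rel (tensor_of A x i j k l) (tensor_of B y i j k l).
  rewrite /tensor_of; case: (count_mem 2%N _) => [|[|[|[|n]]]] /=;
    by [|apply: relN; apply: relD|apply: relD; apply: relD].
have relQ i j k l : rel (square_of A x i j k l) (square_of B y i j k l).
  by do 2 apply: relS => ?; apply: relM.
have rel2 i j : rel (d2_of A x i j) (d2_of B y i j).
  by apply: rel_store => {}i {}j; apply: relS => k.
have rel3 i j : rel (d3_of A x i j) (d3_of B y i j).
  by apply: rel_store => {}i {}j; do 3 apply: relS => ?; apply: relM.
have relMM a b a' b' : (forall i j, rel (a i j) (b i j)) ->
    (forall i j, rel (a' i j) (b' i j)) ->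
    forall i j, rel (mul3 A a a' i j) (mul3 B b b' i j).
  by move=> ab ab'; apply: rel_store => i j; apply: relS => ?; apply: relM.
have relT3 a b : (forall i j, rel (a i j) (b i j)) ->
    rel (trace3 A a) (trace3 B b).
  by move=> ab; apply: relS.
have relAA := relMM _ _ _ _ rel2 rel2; have relBB := relMM _ _ _ _ rel3 rel3.
do 9 (case=> [|]; first by apply: relT3 => //; apply: relMM).
by move=> k; rewrite /= !nth_nil.
Qed.

End Parametricity.

Definition ring_arith (R : pzRingType) : arith R := Arith 0 +%R -%R *%R.

Definition invariant (R : pzRingType) (x : nat -> R) (k : nat) : R :=
  nth 0 (invariants (ring_arith R) x) k.

Arguments invariant : simpl never.

Lemma eq_invariant (R : pzRingType) (x y : nat -> R) k :
  x =1 y -> invariant x k = invariant y k.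
Proof.
move=> xy; apply: (invariants_rel (A := ring_arith R) (B := ring_arith R)
          (rel := eq)) => //=.
- by move=> a _ a' _ <- <-.
- by move=> a _ <-.
by move=> a _ a' _ <- <-.
Qed.

Opaque invariant.

Lemma rmorph_invariant (R S : pzRingType) (f : {rmorphism R -> S}) x k :
  f (invariant x k) = invariant (f \o x) k.
Proof.
apply: (invariants_rel (A := ring_arith R) (B := ring_arith S)
          (rel := fun a b => f a = b)) => //=.
- exact: rmorph0.
- by move=> a _ a' _ <- <-; exact: rmorphD.
- by move=> a _ <-; exact: rmorphN.
- by move=> a _ a' _ <- <-; exact: rmorphM.
Qed.

(** * Vanishing order and first order jets *)

Section Order.
Context (n : nat) (K : comNzRingType).
Implicit Types p q u : {mpoly K[n]}.

Definition vanishes k p := forall m, (mdeg m < k)%N -> p@_m = 0.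

Lemma vanishes0 k : vanishes k 0.
Proof. by move=> m _; rewrite mcoeff0. Qed.

Lemma vanishesD k p q : vanishes k p -> vanishes k q -> vanishes k (p + q).
Proof. by move=> vp vq m mk; rewrite mcoeffD vp ?vq ?addr0. Qed.

Lemma vanishesN k p : vanishes k p -> vanishes k (- p).
Proof. by move=> vp m mk; rewrite mcoeffN vp ?oppr0. Qed.

Lemma vanishesW j k p : (j <= k)%N -> vanishes k p -> vanishes j p.
Proof. by move=> jk vp m mj; apply: vp; apply: leq_trans jk. Qed.

Lemma vanishesM j k p q : vanishes j p -> vanishes k q -> vanishes (j + k) (p * q).
Proof.
move=> vp vq m mjk; rewrite mcoeffM big1 // => -[a b] /= /eqP mE.
case: (ltnP (mdeg a) j) => [aj|ja]; first by rewrite vp ?mul0r.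
rewrite vq ?mulr0 // -(ltn_add2l j); apply: leq_ltn_trans mjk.
by rewrite [m in (_ <= mdeg m)%N]mE mdegD leq_add2r.
Qed.

Lemma vanishesMl k p q : vanishes k q -> vanishes k (p * q).
Proof. by move=> vq; rewrite -[k]add0n; apply: vanishesM. Qed.

Lemma vanishesZ k c p : vanishes k p -> vanishes k (c *: p).
Proof. by move=> vp; rewrite -mul_mpolyC; apply: vanishesMl. Qed.

Lemma vanishes_sum (I : Type) (r : seq I) (P : pred I) k F :
  (forall i, P i -> vanishes k (F i)) -> vanishes k (\sum_(i <- r | P i) F i).
Proof.
by move=> vF; elim/big_ind: _ => //; [apply: vanishes0 | apply: vanishesD].
Qed.

Lemma vanishesX i : vanishes 1 ('X_i : {mpoly K[n]}).
Proof.
move=> m; rewrite ltnS leqn0 mdeg_eq0 => /eqP ->.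
by rewrite mcoeffX -mdeg_eq0 mdeg1.
Qed.

Lemma vanishes_eq0 p : (forall k, vanishes k p) -> p = 0.
Proof. by move=> vp; apply/mpolyP => m; rewrite mcoeff0 (vp (mdeg m).+1). Qed.

(** Both polynomials have order at least [k] at the origin and the same form of degree [k]. *)
Definition close k p q := vanishes k q /\ vanishes k.+1 (p - q).

Lemma closeM j k p q p' q' :
  close j p q -> close k p' q' -> close (j + k) (p * p') (q * q').
Proof.
move=> [vq vpq] [vq' vpq']; split; first exact: vanishesM.
have vp : vanishes j p.
  by rewrite -(subrK q p) addrC; apply: vanishesD => //; apply: vanishesW vpq.
have -> : p * p' - q * q' = p * (p' - q') + (p - q) * q' by ring.
by apply: vanishesD; [rewrite -addnS | rewrite -addSn]; apply: vanishesM.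
Qed.

Lemma close1 : close 0 1 1.
Proof. by split => //; rewrite subrr; apply: vanishes0. Qed.

Lemma closeX k p q : close 1 p q -> close k (p ^+ k) (q ^+ k).
Proof.
move=> pq; elim: k => [|k IH]; first by rewrite !expr0; apply: close1.
by rewrite !exprS -add1n; apply: closeM.
Qed.

(** A substitution tangent to the identity keeps lowest order forms, because it replaces each
    monomial by a polynomial [close] to it. *)
Lemma vanishes_mmap k (h : 'I_n -> {mpoly K[n]}) p :
  (forall i, vanishes 2 (h i - 'X_i)) -> vanishes k p ->
  vanishes k.+1 (mmap (@mpolyC n K) h p - p).
Proof.
move=> hX vp; rewrite {2}(mpolyE p) /mmap -sumrB; apply: vanishes_sum => m _.
rewrite mul_mpolyC -scalerBr; case: (ltnP (mdeg m) k) => [mk|km].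
  by rewrite vp // scale0r; apply: vanishes0.
apply: vanishesZ; apply: (@vanishesW _ (mdeg m).+1) => //.
suff [] : close (mdeg m) (mmap1 h m) 'X_[m] by [].
rewrite mpolyXE_id /mmap1 mdegE.
elim/big_rec3: _ => [|i p1 p2 d _ IH]; first exact: close1.
apply: closeM => //; apply: closeX; split => //; exact: vanishesX.
Qed.

End Order.

Section Jets.
Context (n : nat) (K : comNzRingType) (reduce opposite : nat -> nat).
Hypothesis reduceE : forall a, (reduce a)%:R = a%:R :> K.
Hypothesis oppositeE : forall a, (opposite a)%:R = - a%:R :> K.

(* [(a, s)] stands for [a + sum_i s_i X_i], modulo the square of the ideal of
   the [X_i], with coefficients in [K] represented by natural numbers. *)
Definition jet := (nat * seq nat)%type.

Definition jet_arith : arith jet := Arith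
  (0%N, nseq n 0%N)
  (fun u v => (reduce (u.1 + v.1)%N,
     mkseq (fun i => reduce (nth 0 u.2 i + nth 0 v.2 i)%N) n))
  (fun u => (opposite u.1, mkseq (fun i => opposite (nth 0%N u.2 i)) n))
  (fun u v => (reduce (u.1 * v.1)%N, mkseq (fun i =>
     reduce (u.1 * nth 0 v.2 i + v.1 * nth 0 u.2 i)%N) n)).

Definition linear_part (s : seq nat) : {mpoly K[n]} :=
  \sum_(i < n) (nth 0%N s i)%:R *: 'X_i.

Definition jet_poly (u : jet) : {mpoly K[n]} := u.1%:R%:MP + linear_part u.2.

Definition has_jet (p : {mpoly K[n]}) (u : jet) : Prop :=
  vanishes 2 (p - jet_poly u).

Lemma invariant_jet (x : nat -> {mpoly K[n]}) (u : nat -> jet) k :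
  (forall i, has_jet (x i) (u i)) ->
  has_jet (invariant x k) (nth (azero jet_arith) (invariants jet_arith u) k).
Proof.
have lin1 s : vanishes 1 (linear_part s).
  by apply: vanishes_sum => i _; apply: vanishesZ; apply: vanishesX.
have lin_mkseq (f : nat -> nat) :
    linear_part (mkseq f n) = \sum_(i < n) (f i)%:R *: 'X_i.
  by apply: eq_bigr => i _; rewrite nth_mkseq.
move=> xu; apply: (invariants_rel (A := ring_arith _)) => //=.
- rewrite /has_jet /jet_poly /= mpolyC0 !add0r; apply: vanishesN.
  rewrite /linear_part; apply: vanishes_sum => i _.
  by rewrite nth_nseq if_same scale0r; apply: vanishes0.
- move=> p [a s] q [b t]; rewrite /has_jet /jet_poly /= lin_mkseq reduceE natrD.
  rewrite mpolyCD => pa qb; set S := \sum_(i < n) _.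
  have -> : S = linear_part s + linear_part t.
    rewrite -big_split; apply: eq_bigr => i _ /=.
    by rewrite reduceE natrD scalerDl.
  have := vanishesD pa qb; congr vanishes; ring.
- move=> p [a s]; rewrite /has_jet /jet_poly /= lin_mkseq oppositeE mpolyCN => pa.
  set S := \sum_(i < n) _; have -> : S = - linear_part s.
    by rewrite -sumrN; apply: eq_bigr => i _; rewrite oppositeE scaleNr.
  have := vanishesN pa; congr vanishes; ring.
move=> p [a s] q [b t]; rewrite /has_jet /jet_poly /= lin_mkseq reduceE natrM.
rewrite mpolyCM => pa qb; set S := \sum_(i < n) _.
have -> : S = a%:R%:MP * linear_part t + b%:R%:MP * linear_part s.
  rewrite !mulr_sumr -big_split; apply: eq_bigr => i _ /=.
  by rewrite reduceE natrD !natrM scalerDl !mul_mpolyC !scalerA.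
have v1 := vanishesMl q pa.
have v2 := vanishesMl (a%:R%:MP + linear_part s) qb.
have v3 := vanishesM (lin1 s) (lin1 t).
have := vanishesD (vanishesD v1 v2) v3; congr vanishes; ring.
Qed.

End Jets.

Lemma rmorph_mmap (n : nat) (K : nzRingType) (S U : comNzRingType)
    (f : {rmorphism K -> S}) (h : 'I_n -> S) (phi : {rmorphism S -> U}) p :
  phi (mmap f h p) = mmap (phi \o f) (phi \o h) p.
Proof.
rewrite /mmap rmorph_sum; apply: eq_bigr => m _; rewrite rmorphM /mmap1 rmorph_prod.
by congr (_ * _); apply: eq_bigr => i _; rewrite rmorphXn.
Qed.

Lemma eq_mmap (n : nat) (K S : nzRingType) (f f' : K -> S) (h h' : 'I_n -> S) p :
  f =1 f' -> h =1 h' -> mmap f h p = mmap f' h' p.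
Proof.
by move=> ff hh; apply: eq_bigr => m _; rewrite ff (mmap1_eq _ hh).
Qed.

Lemma mmap_id (n : nat) (K : comNzRingType) (p : {mpoly K[n]}) :
  mmap (@mpolyC n K) (fun i => 'X_i) p = p.
Proof.
rewrite [RHS]mpolyE; apply: eq_bigr => m _.
by rewrite mul_mpolyC mmap1_id.
Qed.

Lemma mmap_comp (n k l : nat) (K : comNzRingType) (h : 'I_n -> {mpoly K[k]})
    (h' : 'I_k -> {mpoly K[l]}) p :
  mmap (@mpolyC l K) h' (mmap (@mpolyC k K) h p) =
  mmap (@mpolyC l K) (fun i => mmap (@mpolyC l K) h' (h i)) p.
Proof.
rewrite rmorph_mmap; apply: eq_mmap => // c /=; exact: mmapC.
Qed.

(* If [g = c + X + O(2)] along suitable substitutions and the [B j] take there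
   values forming an invertible matrix, then the lowest order terms of the
   [Q j (c + X)] are killed by that matrix. *)
Lemma independent_of_jets (K : comNzRingType) (n r N : nat)
    (g : 'I_n -> {mpoly K[N]}) (B : 'I_r -> {mpoly K[N]})
    (h : 'I_r -> 'I_N -> {mpoly K[n]}) (c : 'I_n -> K) (b : 'M[K]_r)
    (L : 'M[K]_r) (Q : 'I_r -> {mpoly K[n]}) :
  (forall t i, vanishes 2 (mmap (@mpolyC n K) (h t) (g i) - ((c i)%:MP + 'X_i))) ->
  (forall t j, vanishes 1 (mmap (@mpolyC n K) (h t) (B j) - (b t j)%:MP)) ->
  L *m b = 1%:M ->
  \sum_j mmap (@mpolyC N K) g (Q j) * B j = 0 -> forall j, Q j = 0.
Proof.
move=> gP BP Lb QB.
(* Recentre at [c], so that orders are measured at the common value of the [g i]. *)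
pose Q' j := mmap (@mpolyC n K) (fun i => 'X_i + (c i)%:MP) (Q j).
suff Q'0 j : Q' j = 0.
  move=> j; have : mmap (@mpolyC n K) (fun i => 'X_i - (c i)%:MP) (Q' j) = 0.
    by rewrite Q'0 mmap0.
  rewrite mmap_comp (eq_mmap (h' := fun i => 'X_i) (f' := @mpolyC n K)) ?mmap_id //.
  by move=> i; rewrite mmapD mmapX mmap1U mmapC subrK.
pose u t i := mmap (@mpolyC n K) (h t) (g i) - (c i)%:MP.
have uX t i : vanishes 2 (u t i - 'X_i).
  by have := gP t i; congr vanishes; rewrite /u; ring.
have Q'E t : \sum_j mmap (@mpolyC n K) (u t) (Q' j) * mmap (@mpolyC n K) (h t) (B j) = 0.
  rewrite -[RHS](raddf0 (mmap (@mpolyC n K) (h t))) -QB raddf_sum;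
    apply: eq_bigr => i _ /=.
  rewrite [RHS]rmorphM; congr (_ * _); rewrite [RHS]mmap_comp [LHS]mmap_comp.
  apply: eq_mmap => // k.
  by rewrite mmapD mmapX mmap1U mmapC subrK.
(* Induction on the order: if all [Q' j] vanish to order [k], then modulo order [k.+1] the
   substitution [u t] acts on them as the identity and [B j] may be replaced by its value [b t j].
   The left inverse [L] then isolates each [Q' j]. *)
apply: vanishes_eq0 => k; elim: k j => [|k IH] j; first by move=> m; rewrite ltn0.
have bQ t : vanishes k.+1 (\sum_j b t j *: Q' j).
  have -> : \sum_j b t j *: Q' j = \sum_j (b t j *: Q' j -
      mmap (@mpolyC n K) (u t) (Q' j) * mmap (@mpolyC n K) (h t) (B j)).
    by rewrite sumrB Q'E subr0.
  apply: vanishes_sum => i _.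
  have vu := vanishes_mmap (uX t) (IH i).
  have vM : vanishes k.+1 (mmap (@mpolyC n K) (u t) (Q' i) *
      (mmap (@mpolyC n K) (h t) (B i) - (b t i)%:MP)).
    rewrite -[k.+1]addn1; apply: vanishesM => //.
    rewrite -[X in vanishes _ X](subrK (Q' i)); apply: vanishesD => //.
    exact: vanishesW vu.
  have := vanishesN (vanishesD vM (vanishesMl (b t i)%:MP vu)).
  by congr vanishes; rewrite -mul_mpolyC; ring.
have -> : Q' j = \sum_t L j t *: \sum_i b t i *: Q' i.
  under eq_bigr => t _ do rewrite scaler_sumr.
  rewrite exchange_big /= -[LHS]scale1r.
  have E i : \sum_t L j t *: (b t i *: Q' i) = (j == i)%:R *: Q' i.
    have /matrixP /(_ j i) := Lb; rewrite !mxE => <-.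
    by rewrite scaler_suml; apply: eq_bigr => t _; rewrite scalerA.
  rewrite (bigD1 j) //= E eqxx big1 ?addr0 // => i /negPf ij.
  by rewrite E eq_sym ij scale0r.
by apply: vanishes_sum => t _; apply: vanishesZ.
Qed.

(** * A certificate modulo 7 *)

(** Total on natural numbers, as the programs read their coordinates from functions on [nat]. *)
Definition var (K : nzRingType) (i : nat) : {mpoly K[9]} :=
  if (i < 9)%N then 'X_(inord i) else 0.

Definition generator (K : nzRingType) (k : 'I_9) : {mpoly K[9]} :=
  invariant (var K) k.

(** Exponents of [I8], [I9], [I10] in the five module generators, in the order of
    [module_degrees]. *)
Definition module_exponents : seq (nat * nat * nat) :=
  [:: (0, 0, 0); (1, 0, 0); (0, 1, 0); (0, 0, 1); (0, 2, 0)]%N.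

Definition tail_mnm (m : 'X_{1..9}) : nat * nat * nat :=
  (m (inord 6), m (inord 7), m (inord 8)).

Definition head_mnm (m : 'X_{1..9}) : 'X_{1..6} :=
  [multinom m (widen_ord (isT : (6 <= 9)%N) i) | i < 6].

Definition standard (m : 'X_{1..9}) : bool := tail_mnm m \in module_exponents.

(* Five points of the fibre of the six parameters over [fibre_value], each with
   a right inverse of the Jacobian matrix of the parameters. *)
Definition fibre_points : seq (seq nat * seq (seq nat)) := [::
  ([:: 4; 4; 6; 3; 2; 3; 5; 3; 6],
   [:: [:: 0; 1; 5; 6; 3; 5]; [:: 1; 6; 5; 5; 5; 2]; [:: 3; 3; 0; 1; 4; 5];
       [:: 2; 5; 0; 0; 0; 1]; [:: 5; 3; 3; 0; 1; 2]; [:: 1; 5; 6; 4; 6; 1]]);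
  ([:: 4; 5; 1; 4; 3; 6; 0; 6; 2],
   [:: [:: 6; 4; 1; 4; 3; 6]; [:: 2; 4; 0; 0; 1; 3]; [:: 0; 5; 4; 0; 6; 1];
       [:: 5; 0; 1; 5; 6; 2]; [:: 0; 6; 3; 6; 5; 6]; [:: 2; 6; 4; 0; 5; 3]]);
  ([:: 3; 2; 3; 4; 4; 4; 3; 6; 1],
   [:: [:: 2; 6; 6; 0; 3; 2]; [:: 1; 3; 4; 4; 6; 4]; [:: 1; 0; 6; 0; 4; 1];
       [:: 0; 0; 2; 2; 6; 3]; [:: 2; 5; 0; 5; 0; 3]; [:: 0; 4; 1; 0; 1; 6]]);
  ([:: 6; 3; 2; 1; 6; 0; 2; 1; 0],
   [:: [:: 6; 3; 4; 5; 2; 0]; [:: 0; 6; 1; 2; 4; 2]; [:: 6; 5; 6; 4; 0; 0];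
       [:: 4; 4; 6; 1; 3; 4]; [:: 1; 1; 1; 5; 1; 1]; [:: 5; 5; 5; 6; 6; 2]]);
  ([:: 2; 6; 1; 5; 6; 2; 3; 6; 1],
   [:: [:: 1; 6; 5; 6; 4; 1]; [:: 6; 5; 3; 3; 1; 0]; [:: 1; 4; 6; 4; 5; 5];
       [:: 0; 1; 3; 3; 4; 5]; [:: 5; 4; 4; 0; 5; 2]; [:: 4; 4; 1; 3; 4; 3]])]%N.

Definition fibre_value : seq nat := [:: 4; 5; 0; 6; 2; 1]%N.

(** Values of [I8], [I9], [I10] at the five points. *)
Definition module_values : seq (seq nat) := [::
  [:: 0; 2; 6]; [:: 1; 6; 2]; [:: 5; 1; 1]; [:: 3; 5; 0]; [:: 3; 4; 6]]%N.

Fixpoint mod7 (a : nat) : nat :=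
  if a is (((((((a'.+1).+1).+1).+1).+1).+1).+1) then mod7 a' else a.

Lemma mod7E a : (mod7 a)%:R = a%:R :> 'F_7.
Proof.
have [n] := ubnP a; elim: n a => // n IH.
do 7 (case=> [//|]); move=> a /= an; rewrite IH; last by lia.
have -> : a.+4.+3 = (a + 7)%N by lia.
by rewrite natrD pchar_Fp_0 ?addr0.
Qed.

Definition opp7 (a : nat) : nat := mod7 (6 * a).

Lemma opp7E a : (opp7 a)%:R = - a%:R :> 'F_7.
Proof. by rewrite mod7E natrM -mulN1r; congr (_ * _); apply/eqP. Qed.

Definition arith7 : arith jet := jet_arith 6 mod7 opp7.

Definition fibre_jet (t i : nat) : jet :=
  let pt := nth ([::], [::]) fibre_points t in
  (nth 0%N pt.1 i, nth [::] pt.2 i).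

(** The second half says that the stored matrices are right inverses of the Jacobians: moving along
    their columns turns each parameter into its common value plus one coordinate, to first order. *)
Lemma fibre_check :
  all (fun t => [seq u.1 | u <- invariants arith7 (fibre_jet t)] ==
         fibre_value ++ nth [::] module_values t) (iota 0 5) &&
  all (fun t => [seq u.2 | u <- take 6 (invariants arith7 (fibre_jet t))] ==
         [seq [seq nat_of_bool (i == j) | j <- iota 0 6] | i <- iota 0 6]) (iota 0 5).
Proof. by vm_compute. Qed.

Definition module_matrix : 'M['F_7]_5 := \matrix_(t < 5, j < 5)
  let v := nth [::] module_values t in
  nth 0 [:: 1; (nth 0%N v 0)%:R; (nth 0%N v 1)%:R; (nth 0%N v 2)%:R;
            (nth 0%N v 1)%:R ^+ 2] j.

Definition module_inverse : 'M['F_7]_5 := \matrix_(t < 5, j < 5)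
  (nth 0 (nth [::] [:: [:: 1; 4; 4; 2; 4]; [:: 5; 1; 2; 0; 6];
     [:: 4; 4; 3; 3; 0]; [:: 0; 6; 6; 6; 3]; [:: 5; 2; 6; 3; 5]] t) j)%N%:R.

Lemma module_inverseP : module_inverse *m module_matrix = 1%:M.
Proof.
apply/matrixP => i j; rewrite !mxE !big_ord_recl big_ord0 !mxE.
case: i => [[|[|[|[|[|i]]]]] ilt] //; case: j => [[|[|[|[|[|j]]]]] jlt] //;
  by apply/eqP; vm_compute.
Qed.

Definition parameter (K : nzRingType) (i : 'I_6) : {mpoly K[9]} :=
  invariant (var K) i.

Definition module_generator (K : nzRingType) (j : 'I_5) : {mpoly K[9]} :=
  let e := nth (0, 0, 0)%N module_exponents j in
  invariant (var K) 6 ^+ e.1.1 * invariant (var K) 7 ^+ e.1.2 *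
  invariant (var K) 8 ^+ e.2.

Definition fibre_subst (t : 'I_5) (i : 'I_9) : {mpoly 'F_7[6]} :=
  jet_poly 6 'F_7 (fibre_jet t i).

Lemma fibre_invariant_jet (t : 'I_5) (k : nat) :
  has_jet (mmap (@mpolyC 6 'F_7) (fibre_subst t) (invariant (var 'F_7) k))
    (nth (azero arith7) (invariants arith7 (fibre_jet t)) k).
Proof.
rewrite (rmorph_invariant (mmap (@mpolyC 6 'F_7) (fibre_subst t))).
apply: (invariant_jet mod7E opp7E) => i; rewrite /= /var; case: ltnP => i9.
  rewrite mmapX mmap1U /fibre_subst inordK // /has_jet subrr; exact: vanishes0.
(* Past the ninth coordinate both the variable and the jet take their default value zero. *)
rewrite mmap0 /has_jet /jet_poly /fibre_jet.
have /(all_nthP ([::], [::])) small :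
  all (fun pt => (size pt.1 <= 9)%N && (size pt.2 <= 9)%N) fibre_points by [].
have /andP[s1 s2] := small t (ltn_ord t).
rewrite /= (nth_default 0%N) ?(leq_trans s1) //.
rewrite (nth_default [::]) ?(leq_trans s2) //.
rewrite mpolyC0 !add0r; apply: vanishesN.
by apply: vanishes_sum => j _; rewrite nth_nil scale0r; apply: vanishes0.
Qed.

Lemma fibre_parameter (t : 'I_5) (i : 'I_6) :
  vanishes 2 (mmap (@mpolyC 6 'F_7) (fibre_subst t) (parameter 'F_7 i) -
    ((nth 0%N fibre_value i)%:R%:MP + 'X_i)).
Proof.
have := fibre_invariant_jet t i; rewrite /has_jet /jet_poly; congr (vanishes _ (_ - _)).
have /andP[/allP c1 /allP c2] := fibre_check.
have tI : (t : nat) \in iota 0 5 by rewrite mem_iota ltn_ord.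
move: (c1 _ tI) (c2 _ tI) => {c1 c2 tI} /eqP c1 /eqP c2.
set u := nth _ _ _.
have -> : u.1 = nth 0%N fibre_value i.
  have := congr1 (fun s => nth 0%N s i) c1.
  rewrite nth_cat ltn_ord => <-; rewrite (nth_map (azero arith7)) //.
  exact: ltn_trans (ltn_ord i) _.
have -> : u.2 = [seq nat_of_bool (i == j :> nat) | j <- iota 0 6].
  have := congr1 (fun s => nth [::] s i) c2.
  rewrite (nth_map 0%N) ?size_iota // nth_iota // add0n => <-.
  rewrite (nth_map (azero arith7)) // nth_take //; exact: ltn_ord.
have sE (j : 'I_6) : nth 0%N [seq nat_of_bool (i == k :> nat) | k <- iota 0 6] j =
  (i == j).
  by rewrite (nth_map 0%N) ?size_iota // nth_iota // add0n.
congr (_ + _); rewrite /linear_part (bigD1 i) // sE eqxx scale1r big1; first exact: addr0.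
by move=> j /negPf ji; rewrite sE eq_sym ji scale0r.
Qed.

Lemma fibre_module (t j : 'I_5) :
  vanishes 1 (mmap (@mpolyC 6 'F_7) (fibre_subst t) (module_generator 'F_7 j) -
    (module_matrix t j)%:MP).
Proof.
have /andP[/allP c1 _] := fibre_check.
have tI : (t : nat) \in iota 0 5 by rewrite mem_iota ltn_ord.
move: (c1 _ tI) => {c1 tI} /eqP c1.
have val k : (k < 3)%N -> close 0 (mmap (@mpolyC 6 'F_7) (fibre_subst t)
    (invariant (var 'F_7) (6 + k)%N)) (nth 0%N (nth [::] module_values t) k)%:R%:MP.
  move=> k3; split=> //;
    have := vanishesW (isT : 1 <= 2)%N (fibre_invariant_jet t (6 + k)).
  set u := nth _ _ _.
  have -> : (nth 0 (nth [::] module_values t) k)%N = u.1.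
    have := congr1 (fun s => nth 0%N s (6 + k)%N) c1.
    rewrite nth_cat -[size fibre_value]/6%N; case: ltnP => [|_].
      by rewrite ltnNge leq_addr.
    rewrite addKn => <-; apply: (nth_map (azero arith7)).
    by rewrite -(ltn_add2l 6) in k3; exact: k3.
  rewrite /jet_poly => vu.
  have vl : vanishes 1 (linear_part 6 'F_7 u.2).
    by apply: vanishes_sum => i _; apply: vanishesZ; apply: vanishesX.
  by have := vanishesD vu vl; congr vanishes; ring.
have valX k e : (k < 3)%N -> close 0 (mmap (@mpolyC 6 'F_7) (fibre_subst t)
    (invariant (var 'F_7) (6 + k)%N ^+ e))
    ((nth 0%N (nth [::] module_values t) k)%:R ^+ e)%:MP.
  move=> k3; rewrite !rmorphXn /=; elim: e => [|e IH].
    by rewrite !expr0; apply: close1.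
  by rewrite !exprS; apply: (@closeM _ _ 0 0); [apply: val|].
pose e := nth (0, 0, 0)%N module_exponents j.
have [_] := closeM (closeM (valX 0%N e.1.1 isT) (valX 1%N e.1.2 isT)) (valX 2%N e.2 isT).
congr (vanishes _ (_ - _)); first by rewrite -!rmorphM.
rewrite -!mpolyCM mxE; congr mpolyC; rewrite /e.
by case: j {e} => [[|[|[|[|[|j]]]]] jlt] //=; rewrite ?expr0 ?expr1 ?mulr1 ?mul1r.
Qed.

Lemma module_independent (Q : 'I_5 -> {mpoly 'F_7[6]}) :
  \sum_j mmap (@mpolyC 9 'F_7) (@parameter 'F_7) (Q j) * module_generator 'F_7 j = 0 ->
  forall j, Q j = 0.
Proof.
exact: independent_of_jets fibre_parameter fibre_module module_inverseP.
Qed.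

Lemma prod_ord3 (R : pzRingType) (F : nat -> R) :
  \prod_(i < 3) F i = F 0%N * F 1%N * F 2%N.
Proof. by rewrite !big_ord_recl big_ord0 mulr1 mulrA. Qed.

Definition power_product (K : nzRingType) (m : 'X_{1..9}) : {mpoly K[9]} :=
  mmap1 (@generator K) m.

Lemma power_productE (K : comNzRingType) (m : 'X_{1..9}) :
  power_product K m = mmap1 (@parameter K) (head_mnm m) *
    (invariant (var K) 6 ^+ m (inord 6) * invariant (var K) 7 ^+ m (inord 7) *
     invariant (var K) 8 ^+ m (inord 8)).
Proof.
rewrite /power_product /mmap1 (@big_split_ord _ _ _ 6 3) /=; congr (_ * _).
  apply: eq_bigr => i _; rewrite mnmE /generator /=; congr (_ ^+ m _).
  exact: val_inj.
transitivity (\prod_(i < 3) invariant (var K) (6 + i)%N ^+ m (inord (6 + i)%N)).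
  apply: eq_bigr => i _; rewrite /generator; congr (_ ^+ m _).
  by apply: val_inj; rewrite /= inordK // -[9%N]/(6 + 3)%N ltn_add2l.
exact: (prod_ord3 (fun i => invariant (var K) (6 + i)%N ^+ m (inord (6 + i)%N))).
Qed.

Lemma mnm9_inj (m m' : 'X_{1..9}) :
  head_mnm m = head_mnm m' -> tail_mnm m = tail_mnm m' -> m = m'.
Proof.
move=> /mnmP hm [m6 m7 m8]; apply/mnmP => i; case: (ltnP i 6) => [i6|].
  have := hm (Ordinal i6); rewrite !mnmE.
  by rewrite (_ : widen_ord _ _ = i); last exact: val_inj.
move=> i6; have : (i : nat) \in [:: 6; 7; 8]%N.
  by have := ltn_ord i; rewrite !inE; lia.
by rewrite !inE => /or3P[] /eqP iE;
  rewrite -(inord_val i) iE.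
Qed.

(** Grouping monomials by their tail turns a combination of standard products into a combination of
    the module generators whose coefficients [Qj] are polynomials in the parameters. *)
Lemma standard_independent_mod7 (Q : {mpoly 'F_7[9]}) :
  all standard (msupp Q) ->
  \sum_(m <- msupp Q) Q@_m *: power_product 'F_7 m = 0 -> Q = 0.
Proof.
move=> /allP stdQ Q0.
pose E j := nth (0, 0, 0)%N module_exponents j.
pose Qj (j : 'I_5) : {mpoly 'F_7[6]} :=
  \sum_(m <- msupp Q | tail_mnm m == E j) Q@_m *: 'X_[head_mnm m].
have Qj0 : forall j, Qj j = 0.
  apply: module_independent; rewrite -[RHS]Q0.
  transitivity (\sum_(j < 5) \sum_(m <- msupp Q | tail_mnm m == E j)
      Q@_m *: power_product 'F_7 m).
    apply: eq_bigr => j _; rewrite raddf_sum mulr_suml; apply: eq_bigr => m /eqP mj.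
    rewrite /= mmapZ mmapX mul_mpolyC -scalerAl power_productE.
    by rewrite /module_generator -/(E j) -mj.
  rewrite (exchange_big_dep xpredT) //= big_seq [RHS]big_seq; apply: eq_bigr => m mQ.
  have := stdQ _ mQ; rewrite /standard -index_mem => jlt.
  rewrite (big_pred1 (Ordinal jlt)) // => j; apply/eqP/eqP => [tE|->].
    apply: val_inj; rewrite -[RHS]/(index (tail_mnm m) module_exponents) tE.
    by rewrite index_uniq // ltn_ord.
  by rewrite /E nth_index // -index_mem.
apply/mpolyP => m; rewrite mcoeff0; apply/eqP; rewrite mcoeff_eq0; apply/negP => mQ.
have := stdQ _ mQ; rewrite /standard -index_mem => jlt.
have := congr1 (mcoeff (head_mnm m)) (Qj0 (Ordinal jlt)).
rewrite mcoeff0 raddf_sum /= (big_rem m) //= {1}/E nth_index ?eqxx;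
  last by rewrite -index_mem.
rewrite big_seq_cond big1 ?addr0.
  by rewrite mcoeffZ mcoeffX eqxx mulr1 => /eqP; rewrite mcoeff_eq0 mQ.
move=> m' /andP[m'Q /eqP tm']; rewrite mcoeffZ mcoeffX; case: eqP => [hm|];
  last by rewrite mulr0.
move: m'Q; rewrite (@mnm9_inj m' m) // ?mem_rem_uniq ?msupp_uniq ?inE ?eqxx //.
by rewrite tm' /E nth_index // -index_mem.
Qed.

(** * Linear independence of polynomials over various fields *)

Section Independence.
Context (n N : nat).

Definition independent (K : fieldType) (G : 'I_n -> {mpoly K[N]}) :=
  forall c : 'I_n -> K, \sum_i c i *: G i = 0 -> forall i, c i = 0.

Definition coef_mx (K : nzRingType) (L : seq 'X_{1..N}) (G : 'I_n -> {mpoly K[N]}) :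
    'M[K]_(n, size L) :=
  \matrix_(i, j) (G i)@_(nth 0%MM L j).

Lemma independentP (K : fieldType) L (G : 'I_n -> {mpoly K[N]}) :
  (forall i, {subset msupp (G i) <= L}) ->
  independent G <-> row_free (coef_mx L G).
Proof.
move=> GL; have comb (c : 'rV[K]_n) : (\sum_i c 0 i *: G i == 0) = (c
  *m coef_mx L G == 0).
  apply/eqP/eqP => [c0|c0].
    apply/matrixP => i j; rewrite !mxE -[RHS](mcoeff0 _ (nth 0%MM L j)) -c0 raddf_sum.
    by apply: eq_bigr => k _; rewrite /= mcoeffZ ord1 !mxE.
  apply/mpolyP => m; rewrite mcoeff0 raddf_sum /=; case: (boolP (m \in L)) => mL.
    have mL' : (index m L < size L)%N by rewrite index_mem.
    have := congr1 (fun M : 'rV_(size L) => M 0 (Ordinal mL')) c0.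
    rewrite !mxE => c1; rewrite -[RHS]c1; apply: eq_bigr => i _.
    by rewrite mcoeffZ !mxE /= nth_index.
  apply: big1 => i _; rewrite mcoeffZ memN_msupp_eq0 ?mulr0 //.
  by apply: contra mL => /GL.
split=> [indG|freeG c c0 i].
  rewrite -kermx_eq0; apply/eqP/row_matrixP => i; rewrite row0.
  have : row i (kermx (coef_mx L G)) *m coef_mx L G = 0.
    by rewrite -row_mul mulmx_ker row0.
  move/eqP; rewrite -comb => /eqP /indG cz; apply/rowP => j.
  by rewrite cz mxE.
have := comb (\row_j c j).
have -> : \sum_j (\row_j0 c j0) 0 j *: G j = 0.
  by rewrite -[RHS]c0; apply: eq_bigr => j _; rewrite mxE.
rewrite eqxx => /esym/eqP; rewrite -[RHS](mul0mx _ (coef_mx L G)).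
by move=> /(row_free_inj freeG) /rowP /(_ i); rewrite !mxE.
Qed.

Lemma coef_mx_map (R S : nzRingType) (f : {rmorphism R -> S}) L
    (G : 'I_n -> {mpoly R[N]}) :
  coef_mx L (fun i => map_mpoly f (G i)) = map_mx f (coef_mx L G).
Proof. by apply/matrixP => i j; rewrite !mxE mcoeff_map_mpoly. Qed.

Definition support (R : nzRingType) (G : 'I_n -> {mpoly R[N]}) : seq 'X_{1..N} :=
  flatten [seq msupp (G i) | i <- enum 'I_n].

Lemma support_map (R S : nzRingType) (f : {rmorphism R -> S})
    (G : 'I_n -> {mpoly R[N]}) i :
  {subset msupp (map_mpoly f (G i)) <= support G}.
Proof.
move=> m; rewrite mcoeff_msupp mcoeff_map_mpoly => fm.
apply/flattenP; exists (msupp (G i)); first by apply: map_f; rewrite mem_enum.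
by rewrite mcoeff_msupp; apply: contra fm => /eqP ->; apply/eqP; exact: (rmorph0 f).
Qed.

(** The rank of the coefficient matrix is unchanged by a field extension; needed for passing from
    the reals to the complex numbers. *)
Lemma independent_map (K E : fieldType) (f : {rmorphism K -> E})
    (G : 'I_n -> {mpoly K[N]}) :
  independent (fun i => map_mpoly f (G i)) <-> independent G.
Proof.
rewrite (@independentP _ (support G)); last exact: support_map.
rewrite (@independentP _ (support G)) ?coef_mx_map ?row_free_map // => i m mG.
by apply/flattenP; exists (msupp (G i)); first by apply: map_f; rewrite mem_enum.
Qed.

(** Lift a right inverse modulo [p] to an integer matrix [B']. Then [\det (M *m B')] is 1 modulo
    [p], hence a nonzero integer, and [M] has full row rank in characteristic zero. *)
Lemma independent_modp (K : numFieldType) (p : nat) (G : 'I_n -> {mpoly int[N]}) :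
  independent (fun i => map_mpoly (intmul 1 : int -> 'F_p) (G i)) ->
  independent (fun i => map_mpoly (intmul 1 : int -> K) (G i)).
Proof.
have sup (R : nzRingType) i :
    {subset msupp (map_mpoly (intmul 1 : int -> R) (G i)) <= support G}.
  exact: support_map.
move/(independentP (sup _)); rewrite coef_mx_map => /row_freeP[B MB].
apply/(independentP (sup _)).
rewrite coef_mx_map; set M := coef_mx _ _ in MB *.
pose B' : 'M[int]_(_, n) := map_mx (fun a : 'F_p => (a : nat)%:Z) B.
have B'E : map_mx (intmul 1 : int -> 'F_p) B' = B.
  by apply/matrixP => i j; rewrite !mxE; exact: natr_Zp.
have d0 : \det (M *m B') != 0.
  apply: contraTneq (oner_neq0 'F_p) => d0; rewrite negbK -(det1 _ n) -MB -B'E.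
  by rewrite -map_mxM det_map_mx d0.
apply/row_freeP; exists (map_mx intr B' *m invmx (map_mx intr (M *m B'))).
rewrite mulmxA -map_mxM mulmxV // unitmxE det_map_mx unitfE.
by rewrite intr_eq0.
Qed.

End Independence.

Lemma map_var (R S : nzRingType) (f : {rmorphism R -> S}) i :
  map_mpoly f (var R i) = var S i.
Proof.
by rewrite /var; case: ifP => _; [rewrite map_mpolyX | rewrite rmorph0].
Qed.

Lemma map_power_product (R S : comNzRingType) (f : {rmorphism R -> S}) m :
  map_mpoly f (power_product R m) = power_product S m.
Proof.
rewrite /power_product /mmap1 rmorph_prod; apply: eq_bigr => k _.
rewrite rmorphXn; congr (_ ^+ _); rewrite /generator.
rewrite rmorph_invariant; apply: eq_invariant => i; exact: map_var.
Qed.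

Lemma standard_independent (K : numFieldType) (s : seq 'X_{1..9}) :
  uniq s -> all standard s ->
  independent (fun i : 'I_(size s) => power_product K (nth 0%MM s i)).
Proof.
move=> us stds.
have map_int (F : comNzRingType) (i : 'I_(size s)) :
    power_product F (nth 0%MM s i) =
    map_mpoly (intmul 1 : int -> F) (power_product int (nth 0%MM s i)).
  by rewrite map_power_product.
suff ind7 : independent (fun i : 'I_(size s) => power_product 'F_7 (nth 0%MM s i)).
  pose G (i : 'I_(size s)) := power_product int (nth 0%MM s i).
  have /(@independent_modp _ _ K 7 G) indK :
      independent (fun i => map_mpoly (intmul 1 : int -> 'F_7) (G i)).
    by move=> c; under eq_bigr => i _ do rewrite -map_int; exact: ind7.
  by move=> c; under eq_bigr => i _ do rewrite map_int; exact: indK.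
move=> c c0 i.
pose Q : {mpoly 'F_7[9]} := \sum_j c j *: 'X_[nth 0%MM s j].
have Qm (j : 'I_(size s)) : Q@_(nth 0%MM s j) = c j.
  rewrite raddf_sum (bigD1 j) //= mcoeffZ mcoeffX eqxx mulr1 big1 ?addr0 // => k kj.
  by rewrite mcoeffZ mcoeffX nth_uniq // (_ : (k == j :> nat) = false) ?mulr0 //;
    apply/negbTE.
have Qs : {subset msupp Q <= s}.
  move=> m; apply: contraLR => ms; apply/negP; rewrite mcoeff_msupp raddf_sum.
  rewrite big1 ?eqxx // => j _; rewrite /= mcoeffZ mcoeffX; case: eqP => [mE|];
    last by rewrite mulr0.
  by rewrite -mE mem_nth in ms.
suff Q0 : Q = 0 by rewrite -Qm Q0 mcoeff0.
apply: standard_independent_mod7; first by apply/allP => m /Qs; exact: (allP stds).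
transitivity (\sum_(m <- s) Q@_m *: power_product 'F_7 m).
  rewrite [RHS](bigID (mem (msupp Q))) /= [X in _ = _ + X]big1 ?addr0; last first.
    by move=> m mQ; rewrite memN_msupp_eq0 ?scale0r.
  rewrite -[RHS]big_filter; apply: perm_big; apply: uniq_perm.
  - exact: msupp_uniq.
  - exact: filter_uniq.
  by move=> m; rewrite mem_filter andb_idr //; exact: Qs.
rewrite -[RHS]c0 (big_nth 0%MM) big_mkord.
by apply: eq_bigr => j _; rewrite Qm.
Qed.

(** * Derivations and the action of sl2 on polynomials in nine variables *)

Lemma mpoly_ring_ind (n : nat) (K : comNzRingType) (P : {mpoly K[n]} -> Prop) :
  (forall c, P c%:MP) -> (forall i, P 'X_i) ->
  (forall p q, P p -> P q -> P (p + q)) ->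
  (forall p q, P p -> P q -> P (p * q)) -> forall p, P p.
Proof.
move=> PC PX PD PM p; rewrite (mpolyE p).
elim/big_rec: _ => [|m q _ Pq]; first by rewrite -mpolyC0.
apply: PD => //; rewrite -mul_mpolyC mpolyXE_id; apply: (PM) => //.
elim/big_rec: _ => [|i r _ Pr]; first by rewrite -mpolyC1.
apply: (PM) => //; elim: (m i) => [|k IH]; first by rewrite expr0 -mpolyC1.
by rewrite exprS; apply: PM.
Qed.

HB.lock Definition lder (n : nat) (K : comNzRingType)
    (c : 'I_n -> {mpoly K[n]}) (p : {mpoly K[n]}) : {mpoly K[n]} :=
  \sum_i c i * p^`M(i).

Section Derivations.
Context (n : nat) (K : comNzRingType).
Implicit Types (p q : {mpoly K[n]}) (a b c : 'I_n -> {mpoly K[n]}).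

Lemma lderE c p : lder c p = \sum_i c i * p^`M(i).
Proof. by rewrite unlock. Qed.

Lemma lder_is_linear c : linear (lder c).
Proof.
move=> k p q; rewrite !lderE scaler_sumr -big_split; apply: eq_bigr => i _ /=.
by rewrite mderivD mderivZ mulrDr scalerAr.
Qed.

HB.instance Definition _ c :=
  GRing.isLinear.Build K {mpoly K[n]} {mpoly K[n]} _ (lder c) (lder_is_linear c).

Lemma lderZ c k p : lder c (k *: p) = k *: lder c p.
Proof. exact: linearZ_LR. Qed.

Lemma lderM c p q : lder c (p * q) = lder c p * q + p * lder c q.
Proof.
rewrite !lderE mulr_suml mulr_sumr -big_split; apply: eq_bigr => i _ /=.
by rewrite mderivM; ring.
Qed.

Lemma lderC c k : lder c k%:MP = 0.
Proof. by rewrite lderE big1 // => i _; rewrite mderivC mulr0. Qed.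

Lemma mderivXU (i j : 'I_n) : ('X_i : {mpoly K[n]})^`M(j) = (i == j)%:R.
Proof.
rewrite mderivX mnm1E; case: eqP => [->|_]; last by rewrite scale0r.
by rewrite scale1r -{1}[U_(j)%MM]add0m addmK mpolyX0.
Qed.

Lemma lderX c i : lder c 'X_i = c i.
Proof.
rewrite !lderE (bigD1 i) //= big1 ?addr0 => [|j /negPf ji].
  by rewrite mderivXU eqxx mulr1.
by rewrite mderivXU eq_sym ji mulr0.
Qed.

Lemma eq_lder a b p : a =1 b -> lder a p = lder b p.
Proof. by move=> ab; rewrite !lderE; apply: eq_bigr => i _; rewrite ab. Qed.

(** The second order terms of the two compositions agree by symmetry of mixed partial derivatives,
    so the difference is again a derivation. *)
Lemma lder_bracket a b p :
  lder a (lder b p) - lder b (lder a p) = lder (fun i => lder a (b i) - lder b (a i)) p.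
Proof.
have E c c' : lder c (lder c' p) = \sum_i lder c (c' i) * p^`M(i) +
    \sum_i \sum_j c i * c' j * p^`M(j)^`M(i).
  rewrite [in LHS](lderE c' p) linear_sum.
  rewrite [X in _ = _ + X]exchange_big -big_split; apply: eq_bigr => i _ /=.
  rewrite lderM; congr (_ + _); rewrite lderE mulr_sumr; apply: eq_bigr => j _.
  by rewrite mulrCA mulrA.
rewrite !E opprD addrACA [X in _ + X](_ : _ = 0) ?addr0.
  by rewrite lderE -sumrB; apply: eq_bigr => i _; rewrite mulrBl.
apply/eqP; rewrite subr_eq0 exchange_big; apply/eqP; apply: eq_bigr => i _.
by apply: eq_bigr => j _; rewrite mderiv_comm [a _ * _]mulrC.
Qed.

Lemma mcoeff_lder_diag (k : 'I_n -> K) p m :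
  (lder (fun i => k i *: 'X_i) p)@_m = (\sum_i k i * (m i)%:R) * p@_m.
Proof.
have diagX m' : lder (fun i => k i *: 'X_i) 'X_[m'] =
    (\sum_i k i * (m' i)%:R) *: 'X_[m'].
  rewrite lderE scaler_suml; apply: eq_bigr => i _; rewrite mderivX -scalerAl -scalerAr.
  rewrite scalerA; case: (posnP (m' i)) => [->|mi]; first by rewrite !mulr0 !scale0r.
  by rewrite -mpolyXD addmC submK // lep1mP -lt0n.
transitivity (\sum_(m' <- msupp p) p@_m' * ((\sum_i k i * (m' i)%:R) * (m' == m)%:R)).
  rewrite [X in lder _ X]mpolyE linear_sum raddf_sum.
  apply: eq_bigr => m' _.
  by rewrite linearZ /= diagX !mcoeffZ mcoeffX.
rewrite [X in _ = _ * X@_m]mpolyE raddf_sum mulr_sumr; apply: eq_bigr => m' _ /=.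
rewrite mcoeffZ mcoeffX; case: eqP => [->|_]; first by ring.
by rewrite !mulr0.
Qed.

End Derivations.

Lemma lder_mmap (K : comNzRingType) (n N : nat) (e : 'I_n -> {mpoly K[n]}) (h
  : 'I_N -> {mpoly K[n]})
    (p : {mpoly K[N]}) :
  lder e (mmap (@mpolyC n K) h p) =
  \sum_i mmap (@mpolyC n K) h p^`M(i) * lder e (h i).
Proof.
pose phi := mmap (@mpolyC n K) h; rewrite -/phi.
elim/mpoly_ring_ind: p => [c|i|p q IHp IHq|p q IHp IHq].
- rewrite /phi mmapC lderC big1 // => i _; by rewrite mderivC mmap0 mul0r.
- rewrite /phi mmapX mmap1U (bigD1 i) //= big1 ?addr0 => [|j /negPf ji].
    by rewrite mderivXU eqxx rmorph1 mul1r.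
  by rewrite mderivXU eq_sym ji mmap0 mul0r.
- rewrite /phi mmapD raddfD /= IHp IHq -big_split; apply: eq_bigr => i _ /=.
  by rewrite mderivD mmapD mulrDl.
rewrite [phi (p * q)]rmorphM lderM IHp IHq mulr_suml mulr_sumr -big_split.
apply: eq_bigr => i _ /=; rewrite mderivM.
have phiD a b : phi (a + b) = phi a + phi b by exact: rmorphD.
have phiM a b : phi (a * b) = phi a * phi b by exact: rmorphM.
by rewrite phiD !phiM; ring.
Qed.


Section Sl2.
Context (K : numFieldType).
Implicit Types (p v : {mpoly K[9]}) (m : 'X_{1..9}).

(* The variable of index [k] has weight [k - 4]. *)
Definition weight m : int := \sum_(i < 9) (i%:Z - 4) * (m i)%:Z.

Definition weight_space (d : nat) (w : int) p :=
  forall m, p@_m != 0 -> mdeg m = d /\ weight m = w.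

Definition euler : {mpoly K[9]} -> {mpoly K[9]} := lder (fun i => 1 *: 'X_i).
Definition weigh : {mpoly K[9]} -> {mpoly K[9]} :=
  lder (fun i : 'I_9 => (i%:Z - 4)%:~R *: 'X_i).
(** With [lower] and [weigh] this is the action of sl2 on nine weight coordinates, normalized by
    [[raise, lower] = 2 weigh]. Where the index of the variable would leave the range, the
    coefficient [8 - i] or [i] vanishes, so the default value of [inord] is harmless. *)
Definition raise : {mpoly K[9]} -> {mpoly K[9]} :=
  lder (fun i : 'I_9 => (8 - i%:Z)%:~R *: 'X_(inord i.+1)).
Definition lower : {mpoly K[9]} -> {mpoly K[9]} :=
  lder (fun i : 'I_9 => i%:R *: 'X_(inord i.-1)).

HB.instance Definition _ := GRing.Linear.copy euler (lder (fun i : 'I_9 => 1 *: 'X_i)).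
HB.instance Definition _ := GRing.Linear.copy weigh
  (lder (fun i : 'I_9 => (i%:Z - 4)%:~R *: 'X_i)).
HB.instance Definition _ := GRing.Linear.copy raise
  (lder (fun i : 'I_9 => (8 - i%:Z)%:~R *: 'X_(inord i.+1))).
HB.instance Definition _ := GRing.Linear.copy lower
  (lder (fun i : 'I_9 => i%:R *: 'X_(inord i.-1))).

(** With degree and weight as eigenvalues of two derivations, the effect of [raise] and [lower] on
    them follows from brackets. The converse compares eigenvalues in [K] and rests on characteristic
    zero. *)
Lemma weight_spaceP d w p :
  weight_space d w p <-> euler p = d%:R *: p /\ weigh p = w%:~R *: p.
Proof.
have E m : (euler p)@_m = (mdeg m)%:R * p@_m.
  rewrite mcoeff_lder_diag mdegE natr_sum; congr (_ * _).
  by apply: eq_bigr => i _; rewrite mul1r.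
have W m : (weigh p)@_m = (weight m)%:~R * p@_m.
  rewrite mcoeff_lder_diag /weight rmorph_sum; congr (_ * _).
  by apply: eq_bigr => i _; rewrite rmorphM.
split=> [dw|[Ep Wp] m pm].
  by split; apply/mpolyP => m; rewrite ?E ?W mcoeffZ;
    have [->|/dw[md mw]] := eqVneq p@_m 0; rewrite ?mulr0 ?md ?mw.
have := congr1 (mcoeff m) Ep; have := congr1 (mcoeff m) Wp.
rewrite E W !mcoeffZ => /(mulIf pm)/eqP + /(mulIf pm)/eqP.
by rewrite eqr_int eqr_nat => /eqP -> /eqP ->.
Qed.

Lemma bracketE (a b c : 'I_9 -> {mpoly K[9]}) p :
  (forall i, lder a (b i) - lder b (a i) = c i) ->
  lder a (lder b p) = lder b (lder a p) + lder c p.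
Proof.
by move=> /eq_lder <-; rewrite -lder_bracket addrC subrK.
Qed.

Lemma lder0 p : lder (fun=> 0) p = 0.
Proof. by rewrite lderE big1 // => i _; rewrite mul0r. Qed.

Lemma lderZl (k : K) (a : 'I_9 -> {mpoly K[9]}) p :
  lder (fun i => k *: a i) p = k *: lder a p.
Proof. by rewrite !lderE scaler_sumr; apply: eq_bigr => i _; rewrite scalerAl. Qed.

Lemma euler_raise p : euler (raise p) = raise (euler p).
Proof.
rewrite /euler /raise (@bracketE _ _ (fun=> 0)) ?lder0 ?addr0 // => i.
by rewrite !lderZ !lderX !scale1r subrr.
Qed.

Lemma euler_lower p : euler (lower p) = lower (euler p).
Proof.
rewrite /euler /lower (@bracketE _ _ (fun=> 0)) ?lder0 ?addr0 // => i.
by rewrite !lderZ !lderX !scale1r subrr.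
Qed.

Lemma weigh_raise p : weigh (raise p) = raise (weigh p) + raise p.
Proof.
apply: bracketE => i; rewrite !lderZ !lderX /= !scalerA. rewrite -scalerBl.
have [i8|i8] := eqVneq (i : nat) 8%N.
  by rewrite i8 subrr !mul0r mulr0 subrr.
have i9 : (i.+1 < 9)%N by have := ltn_ord i; lia.
rewrite inordK //; congr (_ *: _); rewrite -!intrM -intrB; congr (_%:~R); lia.
Qed.

Lemma weigh_lower p : weigh (lower p) = lower (weigh p) - lower p.
Proof.
rewrite -[- _]scaleN1r -lderZl; apply: bracketE => i.
rewrite !lderZ !lderX /= !scalerA -scalerBl.
have [i0|i0] := eqVneq (i : nat) 0%N.
  by rewrite i0 mulr0n !mulr0 !mul0r subrr.
rewrite inordK; last by have := ltn_ord i; lia.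
congr (_ *: _); rewrite mulN1r -[i%:R]/(i%:Z%:~R) -!intrM -intrB -mulrNz; congr (_%:~R).
rewrite (_ : i.-1%:Z = i%:Z - 1); [ring | lia].
Qed.

Lemma raise_lower p : raise (lower p) = lower (raise p) + weigh p *+ 2.
Proof.
rewrite -[_ *+ 2]scaler_nat -lderZl; apply: bracketE => i.
rewrite !lderZ !lderX /= !scalerA.
have Xi (k : nat) : k = i -> 'X_(inord k) = 'X_i :> {mpoly K[9]}.
  by move=> ->; rewrite inord_val.
transitivity (((i%:Z * (9 - i%:Z))%:~R - ((8 - i%:Z) * (i%:Z + 1))%:~R) *: 'X_i
                : {mpoly K[9]}).
  rewrite scalerBl; congr (_ - _).
    have [i0|i0] := eqVneq (i : nat) 0%N; first by rewrite i0 !mul0r !scale0r.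
    rewrite inordK; last by have := ltn_ord i; lia.
    rewrite Xi; last by lia.
    congr (_ *: _); rewrite -[i%:R]/(i%:Z%:~R) -!intrM; congr (_%:~R).
    rewrite (_ : i.-1%:Z = i%:Z - 1); [ring | lia].
  have [i8|i8] := eqVneq (i : nat) 8%N; first by rewrite i8 subrr !mul0r !scale0r.
  rewrite inordK; last by have := ltn_ord i; lia.
  rewrite Xi //; congr (_ *: _); rewrite -[i.+1%:R]/(i.+1%:Z%:~R) -!intrM.
  by congr (_%:~R); rewrite intS; ring.
rewrite -intrB; congr (_ *: _); rewrite -[2%:R]/(2%:Z%:~R) -intrM.
by congr (_%:~R); ring.
Qed.

Lemma weight_space_raise d w p : weight_space d w p -> weight_space d (w + 1) (raise p).
Proof.
move=> /weight_spaceP[ep wp]; apply/weight_spaceP.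
rewrite euler_raise ep weigh_raise wp !linearZ /=; split=> //.
by rewrite rmorphD scalerDl scale1r.
Qed.

Lemma weight_space_lower d w p : weight_space d w p -> weight_space d (w - 1) (lower p).
Proof.
move=> /weight_spaceP[ep wp]; apply/weight_spaceP.
rewrite euler_lower ep weigh_lower wp !linearZ /=; split=> //.
by rewrite rmorphB scalerBl scale1r.
Qed.

Lemma weight_spaceD d w p q :
  weight_space d w p -> weight_space d w q -> weight_space d w (p + q).
Proof.
move=> /weight_spaceP[ep wp] /weight_spaceP[eq wq]; apply/weight_spaceP.
by rewrite !raddfD /= ep eq wp wq.
Qed.

Lemma weight_spaceZ d w c p : weight_space d w p -> weight_space d w (c *: p).
Proof.
move=> /weight_spaceP[ep wp]; apply/weight_spaceP.
by rewrite !linearZ /= ep wp !scalerA ![c * _]mulrC.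
Qed.

Lemma weight_le m : weight m <= 4 * (mdeg m)%:Z.
Proof.
rewrite /weight mdegE (big_morph _ PoszD (erefl _)) mulr_sumr; apply: ler_sum => i _.
by apply: ler_wpM2r => //; have := ltn_ord i; lia.
Qed.

(* Downward induction on the weight: [[raise, lower] = 2 w] on weight [w], so
   solving the equation with constant [c + 2 w] in weight [w + 1] for
   [raise v] gives [y], and [u = (v - lower y) / (c + 2 w)]. *)
Lemma raise_lower_surj d w (c : K) v : 0 < w -> 0 <= c -> weight_space d w v ->
  exists2 u, weight_space d w u & raise (lower u) + c *: u = v.
Proof.
move=> w0 c0; have [n] := ubnP `|(4 * d%:Z - w + 1)%R|%N.
elim: n w c v w0 c0 => // n IH w c v w0 c0 wn vP.
(* Above the top weight [4 d] the weight space is zero, which ends the induction. *)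
have [wd|dw] := ltP (4 * d%:Z) w.
  exists 0; first by move=> m; rewrite mcoeff0 eqxx.
  rewrite !raddf0 addr0; apply/mpolyP => m; rewrite mcoeff0.
  apply/esym/eqP; apply/negP => /negP /vP[md mw].
  by have := weight_le m; rewrite md mw; lia.
pose e : K := w%:~R *+ 2 + c.
have e0 : 0 < e.
  by rewrite /e ltr_pwDl // pmulrn_lgt0 // ltr0z.
have [||||y yP yE] := IH (w + 1) e (raise v); first by lia.
- exact: ltW.
- by have := dw; lia.
- exact: weight_space_raise.
have lyP : weight_space d w (lower y).
  by have := weight_space_lower yP; rewrite addrK.
exists (e^-1 *: (v - lower y)).
  by apply/weight_spaceZ/weight_spaceD => //; rewrite -scaleN1r; apply: weight_spaceZ.
set z := v - lower y.
have zP : weight_space d w z.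
  by apply/weight_spaceD => //; rewrite -scaleN1r; apply: weight_spaceZ.
rewrite !linearZ /= raise_lower.
have [_ ->] := (weight_spaceP d w z).1 zP.
have -> : raise z = e *: y.
  by rewrite /z raddfB /= -yE addrC addKr.
rewrite -scalerDr linearZ /= -scaler_nat scalerA.
have -> : e *: lower y + (2%:R * w%:~R) *: z + c *: z = e *: v.
  rewrite -addrA -scalerDl (_ : 2%:R * w%:~R + c = e) -?scalerDr.
    by rewrite /z addrC subrK.
  by rewrite mulr_natl.
by rewrite scalerA mulVf ?scale1r // gt_eqF.
Qed.

Lemma raise_surj d v : weight_space d 1 v ->
  exists2 u, weight_space d 0 u & raise u = v.
Proof.
move=> /(@raise_lower_surj d 1 0)[//|//|u uP uE]; exists (lower u).
  by have := weight_space_lower uP; rewrite subrr.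
by rewrite -uE scale0r addr0.
Qed.

End Sl2.

(** * Weight multiplicities and the bound on highest weight vectors *)

Lemma cnt_perm s t d w : graded s -> perm_eq s t -> cnt s d w = cnt t d w.
Proof.
elim: s t d w => [|[i j] s IH] t d w gs st.
  by move: st; rewrite perm_sym => /perm_nilP ->.
have: (i, j) \in t by rewrite -(perm_mem st) mem_head.
move=> ijt; case/splitPr: ijt st => t1 t2 st.
have gt : graded (t1 ++ (i, j) :: t2) by rewrite /graded -(perm_all _ st).
move: gt gs; rewrite graded_cat /= => /and3P[g1 i0 g2] /andP[_ gs].
have {}st : perm_eq s (t1 ++ t2).
  rewrite -(perm_cons (i, j)) (perm_trans st) // -[_ :: t2]cat1s perm_catCA.
  exact: perm_refl.
rewrite cnt_move // !(@cntE `|d|.+1) ?graded_cat ?g1 //; try lia.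
by apply: eq_bigr => k _; apply: IH.
Qed.

(** The entries of [octavic_weights] in the order of the variables; there they are grouped by sign
    for the partial fractions. *)
Definition index_weights : seq (int * int) := [seq (1, k%:Z - 4) | k <- iota 0 9].

Definition mnm_of (s : seq nat) : 'X_{1..9} := [multinom nth 0%N s i | i < 9].

Definition weight_mnms (d : nat) (w : int) : seq 'X_{1..9} :=
  [seq mnm_of s | s <- mons index_weights d%:Z w].

Lemma size_weight_mnms d w : (size (weight_mnms d w))%:Z = cnt octavic_weights d%:Z w.
Proof. by rewrite size_map; apply: cnt_perm. Qed.

Lemma dot_natE ds s : size s = size ds ->
  dot_nat ds s = \sum_(i < size ds) (nth 0%N s i)%:Z * nth 0 ds i.
Proof.
elim: ds s => [|a ds IH] [|k s] //= => [_|[ss]]; first by rewrite big_ord0.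
by rewrite big_ord_recl /= IH.
Qed.

Lemma mem_weight_mnms d w m : (m \in weight_mnms d w) = (mdeg m == d) && (weight m == w).
Proof.
have E s : size s = 9%N -> (s \in mons index_weights d%:Z w) =
    (mdeg (mnm_of s) == d) && (weight (mnm_of s) == w).
  move=> ss; rewrite mem_mons // ss !dot_natE ?ss // eqxx /=; congr (_ && _).
    rewrite -eqz_nat mdegE (big_morph _ PoszD (erefl _)); congr (_ == _).
    apply: eq_bigr => i _; rewrite mnmE.
    by rewrite [X in _ * X](_ : _ = 1) ?mulr1 //;
      case: i => [[|[|[|[|[|[|[|[|[|i]]]]]]]]] ?].
  congr (_ == _); apply: eq_bigr => i _; rewrite mnmE mulrC; congr (_ * _).
  by case: i => [[|[|[|[|[|[|[|[|[|i]]]]]]]]] ?].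
have mK : mnm_of (m : seq nat) = m.
  by apply/mnmP => i; rewrite mnmE -tnth_nth.
apply/mapP/idP => [[s sP ->]|mP].
  have ss : size s = 9%N.
    by move: sP; rewrite mem_mons // => /and3P[/eqP -> _ _].
  by rewrite -E.
exists (m : seq nat) => //; by rewrite E ?size_tuple // mK.
Qed.

Lemma uniq_weight_mnms d w : uniq (weight_mnms d w).
Proof.
rewrite map_inj_in_uniq ?uniq_mons // => s t.
rewrite !mem_mons // => /and3P[/eqP ss _ _] /and3P[/eqP st _ _] /mnmP E.
apply: (@eq_from_nth _ 0%N); first by rewrite ss st.
by move=> i; rewrite ss => i9; have := E (Ordinal i9); rewrite !mnmE.
Qed.

(** The matrix [ME] of [raise] from weight 0 to weight 1 has full column rank by [raise_surj], and
    the [n] independent rows of coefficients of the [G i] lie in its left kernel. *)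
Lemma highest_weight_bound (K : numFieldType) (n d : nat) (G : 'I_n -> {mpoly K[9]}) :
  (forall i, weight_space d 0 (G i)) -> (forall i, raise (G i) = 0) ->
  independent G ->
  n%:Z + cnt octavic_weights d%:Z 1 <= cnt octavic_weights d%:Z 0.
Proof.
move=> Gd EG indG; rewrite -!size_weight_mnms.
move: (weight_mnms d 0) (weight_mnms d 1) (mem_weight_mnms d 0) (mem_weight_mnms d 1)
  (uniq_weight_mnms d 0) (uniq_weight_mnms d 1) => L0 L1 L0P L1P u0 u1.
have inL0 (p : {mpoly K[9]}) : weight_space d 0 p -> {subset msupp p <= L0}.
  by move=> pd m; rewrite mcoeff_msupp L0P => /pd [-> ->]; rewrite !eqxx.
have expand (p : {mpoly K[9]}) : weight_space d 0 p ->
    p = \sum_(i < size L0) p@_(nth 0%MM L0 i) *: 'X_[nth 0%MM L0 i].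
  move=> pd; transitivity (\sum_(m <- L0) p@_m *: 'X_[m]).
    rewrite [LHS]mpolyE [RHS](bigID (mem (msupp p))) /= [X in _ = _ + X]big1 ?addr0;
      last first.
      by move=> m mQ; rewrite memN_msupp_eq0 ?scale0r.
    rewrite -[RHS]big_filter; apply: perm_big; apply: uniq_perm.
    - exact: msupp_uniq.
    - exact: filter_uniq.
    by move=> m; rewrite mem_filter andb_idr //; exact: inL0.
  by rewrite (big_nth 0%MM) big_mkord.
pose ME : 'M[K]_(size L0, size L1) :=
  \matrix_(i, j) (raise 'X_[nth 0%MM L0 i])@_(nth 0%MM L1 j).
have coefE (p : {mpoly K[9]}) j : weight_space d 0 p ->
    (raise p)@_(nth 0%MM L1 j) = \sum_(i < size L0) p@_(nth 0%MM L0 i) *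
      (raise 'X_[nth 0%MM L0 i])@_(nth 0%MM L1 j).
  move=> pd; rewrite [in LHS](expand p pd) linear_sum raddf_sum; apply: eq_bigr => i _.
  by rewrite /= linearZ /= mcoeffZ.
have GE : coef_mx L0 G *m ME = 0.
  apply/matrixP => i j; rewrite !mxE -[RHS](mcoeff0 _ (nth 0%MM L1 j)) -(EG i) coefE //.
  by apply: eq_bigr => k _; rewrite !mxE.
have rG : \rank (coef_mx L0 G) = n.
  apply/eqP; have /(independentP (L := L0)) : independent G by [].
  by apply => i; apply: inL0.
have /fin_all_exists [u uP] : forall j : 'I_(size L1), exists u : {mpoly K[9]},
    weight_space d 0 u /\ raise u = 'X_[nth 0%MM L1 j].
  move=> j; have jL : nth 0%MM L1 j \in L1 by rewrite mem_nth.
  have [|u uP uE] := @raise_surj K d 'X_[nth 0%MM L1 j]; last by exists u.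
  move=> m; rewrite mcoeffX; case: (_ =P m) => [<- _|_]; last by rewrite eqxx.
  by move: jL; rewrite L1P => /andP[/eqP -> /eqP ->].
have rE : \rank ME = size L1.
  apply/eqP; rewrite eqn_leq rank_leq_col /=.
  (* The rows of [U] are preimages under [raise] of the monomials of weight 1, so [U] is a left
     inverse of [ME]. *)
  pose U : 'M[K]_(size L1, size L0) := \matrix_(j, i) (u j)@_(nth 0%MM L0 i).
  suff UE : \rank (U *m ME) = size L1 by rewrite -[X in (X <= _)%N]UE mxrankM_maxr.
  rewrite (_ : _ *m _ = 1%:M) ?mxrank1 //; apply/matrixP => j k; rewrite !mxE.
  have [ud uE] := uP j; have := coefE _ k ud; rewrite uE mcoeffX nth_uniq // => E.
  rewrite -[RHS]/((j == k :> nat)%:R) E; apply: eq_bigr => i _; by rewrite !mxE.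
have := mulmx0_rank_max GE; rewrite rG rE; lia.
Qed.

(** * Coordinates on harmonic tensors *)

Definition idx (k : nat) : 'I_3 :=
  match k with 0 => Ordinal (isT : 0 < 3)%N | 1 => Ordinal (isT : 1 < 3)%N
             | _ => Ordinal (isT : 2 < 3)%N end.

(** The nondecreasing index with [b] ones and [c] twos: position [a] gets one unit if it lies in the
    last [b + c] places and another if it lies in the last [c]. *)
Definition sorted_idx (b c : nat) : 4.-tuple 'I_3 :=
  let f a := idx ((4 <= a + b + c)%N + (4 <= a + c)%N) in
  [tuple f 0%N; f 1%N; f 2%N; f 3%N].

Definition mult_idx (k : nat) (t : 4.-tuple 'I_3) : nat :=
  count_mem k [seq nat_of_ord i | i <- t].

Lemma tuple4_ind (P : 4.-tuple 'I_3 -> Prop) :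
  (forall i j k l : nat, (i < 3)%N -> (j < 3)%N -> (k < 3)%N -> (l < 3)%N ->
    P [tuple idx i; idx j; idx k; idx l]) -> forall t, P t.
Proof.
move=> PP t; have idxE (i : 'I_3) : i = idx i.
  by apply: val_inj; case: i => [[|[|[|i]]] ?].
have -> : t = [tuple idx (tnth t 0); idx (tnth t 1); idx (tnth t 2%:R);
  idx (tnth t 3%:R)].
  apply: eq_from_tnth => a; rewrite -!idxE.
  by case: a => [[|[|[|[|a]]]] alt] //; rewrite [RHS](tnth_nth 0) /=; congr tnth;
    apply: val_inj.
exact: PP.
Qed.

Lemma sorted_idx_perm (t : 4.-tuple 'I_3) :
  perm_eq t (sorted_idx (mult_idx 1 t) (mult_idx 2 t)).
Proof.
elim/tuple4_ind: t => i j k l.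
case: i => [|[|[|i]]] //; case: j => [|[|[|j]]] //;
  case: k => [|[|[|k]]] //; case: l => [|[|[|l]]] //.
Qed.

Lemma mult_idx_le4 t : (mult_idx 1 t + mult_idx 2 t <= 4)%N.
Proof.
elim/tuple4_ind: t => i j k l.
by case: i => [|[|[|i]]] //; case: j => [|[|[|j]]] //;
  case: k => [|[|[|k]]] //; case: l => [|[|[|l]]].
Qed.

Section Coordinates.
Context (R : realType).
Local Notation A := (ring_arith R).

Definition tensor_coords (x : nat -> R) : tensor4 R :=
  [ffun t : 4.-tuple 'I_3 => component A x (mult_idx 1 t) (mult_idx 2 t)].

Lemma tensor_coordsE x (i j k l : 'I_3) :
  tensor_coords x [tuple i; j; k; l] = tensor_of A x i j k l.
Proof. by rewrite ffunE. Qed.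

Lemma tensor_coords_harmonic x : harmonic (tensor_coords x).
Proof.
apply/andP; split.
  apply/forallP => s; apply/forallP => t; rewrite !ffunE.
  have E : perm_eq (permute_idx s t) t by apply/tuple_permP; exists s.
  by rewrite /mult_idx !(seq.permP (perm_map _ E)).
apply/forallP => i; apply/forallP => j; apply/eqP.
under eq_bigr do rewrite tensor_coordsE.
rewrite !big_ord_recl big_ord0.
by case: i => [[|[|[|i]]] ?]; case: j => [[|[|[|j]]] ?] //;
  rewrite /tensor_of /=; ring.
Qed.

Definition of_coords (x : nat -> R) : H4 R := 
  exist (fun T : tensor4 R => harmonic T) (tensor_coords x) (tensor_coords_harmonic x).

Definition coord_idx (k : nat) : 4.-tuple 'I_3 :=
  if (k < 5)%N then sorted_idx k 0 else sorted_idx (k - 5) 1.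

Definition coord (H : H4 R) (k : nat) : R := val H (coord_idx k).

Lemma of_coordsK H : of_coords (coord H) = H.
Proof.
case: H => T hT; apply: val_inj; rewrite [RHS]/=.
have /andP[/forallP symT /forallP trT] := hT.
have sT (t u : 4.-tuple 'I_3) : perm_eq t u -> T t = T u.
  move=> /tuple_permP[s tu]; have /forallP /(_ u) /eqP <- := symT s.
  by congr (T _); apply: val_inj.
apply/ffunP => t; rewrite ffunE [RHS](sT _ _ (sorted_idx_perm t)).
have sumE (F : 'I_3 -> R) : \sum_k F k = F (idx 0) + F (idx 1) + F (idx 2).
  rewrite !big_ord_recl big_ord0 addr0 addrA.
  by congr (F _ + F _ + F _); apply: val_inj.
(* After sorting, the trace condition trades a pair of indices 2 for pairs 0 and pairs 1; at most
   two such trades bring [c] down to 0 or 1. *)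
have tr i j : T [tuple idx 2; idx 2; i; j] =
    - (T [tuple idx 0; idx 0; i; j] + T [tuple idx 1; idx 1; i; j]).
  have /forallP /(_ j) := trT i; rewrite sumE addrC addr_eq0 => /eqP ->.
  by [].
move: (mult_idx_le4 t).
rewrite /coord [val _]/=; move: (mult_idx 1 t) (mult_idx 2 t) => b c.
case: c => [|[|[|[|[|c]]]]]; last by move=> ?; lia.
- by rewrite addn0 /= /coord_idx ltnS => ->.
- by move=> _; rewrite /= /coord_idx ltnNge leq_addr addKn.
- case: b => [|[|[|b]]]; last by move=> ?; lia.
  + rewrite (sT (sorted_idx 0 2) [tuple idx 2; idx 2; idx 0; idx 0]) // tr.
    by rewrite (sT [tuple idx 1; idx 1; _; _] (sorted_idx 2 0)).
  + rewrite (sT (sorted_idx 1 2) [tuple idx 2; idx 2; idx 0; idx 1]) // tr.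
    by rewrite (sT [tuple idx 1; idx 1; _; _] (sorted_idx 3 0)).
  by rewrite (sT (sorted_idx 2 2) [tuple idx 2; idx 2; idx 1; idx 1]) // tr.
- case: b => [|[|b]]; last by move=> ?; lia.
  + rewrite (sT (sorted_idx 0 3) [tuple idx 2; idx 2; idx 0; idx 2]) // tr.
    by rewrite (sT [tuple idx 1; idx 1; _; _] (sorted_idx 2 1)).
  by rewrite (sT (sorted_idx 1 3) [tuple idx 2; idx 2; idx 1; idx 2]) // tr.
case: b => [|b]; last by move=> ?; lia.
rewrite -[sorted_idx 0 4]/[tuple idx 2; idx 2; idx 2; idx 2] tr.
rewrite (sT [tuple idx 0; idx 0; idx 2; idx 2] [tuple idx 2; idx 2; idx 0; idx 0]) //.
rewrite (sT [tuple idx 1; idx 1; idx 2; idx 2] [tuple idx 2; idx 2; idx 1; idx 1]) // !tr.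
rewrite (sT [tuple idx 1; idx 1; idx 0; idx 0] (sorted_idx 2 0)) //.
by rewrite opprD !opprK.
Qed.

(** * The nine invariants in coordinates *)

Lemma sum3E (f : nat -> R) : sum3 A f = \sum_(i < 3) f i.
Proof. by rewrite !big_ord_recl big_ord0. Qed.

Lemma storeE (f : nat -> nat -> R) (i j : 'I_3) : store A f i j = f i j.
Proof. by case: i => [[|[|[|i]]] ?] //; case: j => [[|[|[|j]]] ?]. Qed.

Definition mx3 (f : nat -> nat -> R) : 'M[R]_3 := \matrix_(i, j) f i j.

Lemma trace3E f : trace3 A f = \tr (mx3 f).
Proof. by rewrite /trace3 sum3E; apply: eq_bigr => i _; rewrite mxE. Qed.

Lemma mul3E f g : mx3 (mul3 A f g) = mx3 f *m mx3 g.
Proof.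
apply/matrixP => i j; rewrite !mxE /mul3 storeE sum3E.
by apply: eq_bigr => k _; rewrite !mxE.
Qed.

Lemma d2E x : d2 (of_coords x) = mx3 (d2_of A x).
Proof.
apply/matrixP => i j; rewrite !mxE /d2_of storeE sum3E; apply: eq_bigr => k _.
rewrite ffunE /square_of sum3E; apply: eq_bigr => p _.
by rewrite sum3E; apply: eq_bigr => q _; rewrite !tensor_coordsE.
Qed.

Lemma d3E x : d3 (of_coords x) = mx3 (d3_of A x).
Proof.
apply/matrixP => i j; rewrite !mxE /d3_of storeE sum3E; apply: eq_bigr => k _.
rewrite ffunE sum3E; apply: eq_bigr => p _; rewrite sum3E; apply: eq_bigr => q _.
rewrite tensor_coordsE ffunE /square_of; congr (_ * _).
rewrite sum3E; apply: eq_bigr => r _; rewrite sum3E; apply: eq_bigr => s _.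
by rewrite !tensor_coordsE.
Qed.

Definition octavic : 9.-tuple (H4 R -> R) :=
  [tuple @I2 R; @I3 R; @I4 R; @I5 R; @I6 R; @I7 R; @I8 R; @I9 R; @I10 R].

Lemma octavicE (k : 'I_9) x : tnth octavic k (of_coords x) = invariant x k.
Proof.
pose a := d2_of A x; pose b := d3_of A x.
have sq (M : 'M[R]_3) : M ^+ 2 = M *m M by rewrite expr2.
have cube (M : 'M[R]_3) : M ^+ 3 = M *m (M *m M) by rewrite exprS expr2.
have E f g : \tr (mx3 f *m mx3 g) = trace3 A (mul3 A f g) by rewrite trace3E mul3E.
rewrite (tnth_nth (@I2 R)); case: k => [[|[|[|[|[|[|[|[|[|k]]]]]]]]] ?] //.
- by rewrite -[LHS]/(\tr (d2 (of_coords x))) d2E -trace3E.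
- by rewrite -[LHS]/(\tr (d3 (of_coords x))) d3E -trace3E.
- by rewrite -[LHS]/(\tr (d2 (of_coords x) ^+ 2)) sq d2E E.
- by rewrite -[LHS]/(\tr (d2 (of_coords x) *m d3 (of_coords x))) d2E d3E E.
- by rewrite -[LHS]/(\tr (d2 (of_coords x) ^+ 3)) cube d2E -mul3E E.
- rewrite -[LHS]/(\tr (d2 (of_coords x) ^+ 2 *m d3 (of_coords x))).
  by rewrite sq d2E d3E -mul3E E.
- rewrite -[LHS]/(\tr (d2 (of_coords x) *m d3 (of_coords x) ^+ 2)).
  by rewrite sq d2E d3E -mul3E E.
- by rewrite -[LHS]/(\tr (d3 (of_coords x) ^+ 3)) cube d3E -mul3E E.
rewrite -[LHS]/(\tr (d2 (of_coords x) ^+ 2 *m d3 (of_coords x) ^+ 2)).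
by rewrite !sq d2E d3E -(mul3E a a) -(mul3E b b) E.
Qed.

Lemma octavic_coord (k : 'I_9) H : tnth octavic k H = invariant (coord H) k.
Proof. by rewrite -{1}(of_coordsK H) octavicE. Qed.

Lemma octavic_polynomial (k : 'I_9) : polynomial_function (tnth octavic k).
Proof.
exists (invariant (fun i => 'X_(enum_rank (coord_idx i))) k) => H.
rewrite octavic_coord rmorph_invariant; apply: eq_invariant => i /=.
by rewrite mevalXU enum_rankK.
Qed.

End Coordinates.

(** * Invariance under O(3) *)

Section Equivariance.
Context (R : realType).
Local Notation pairs := ('I_3 * 'I_3)%type.
Implicit Types (g : 'M[R]_3) (T U : tensor4 R).

(* Tensors of order four as endomorphisms of the tensors of order two. *)
Definition unfold4 T : 'M[R]_#|{: pairs}| := \matrix_(a, b)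
  T [tuple (enum_val a).1; (enum_val a).2; (enum_val b).1; (enum_val b).2].

Definition kron g : 'M[R]_#|{: pairs}| := \matrix_(a, b)
  (g (enum_val a).1 (enum_val b).1 * g (enum_val a).2 (enum_val b).2).

Lemma sum_pairs (F : 'I_3 -> 'I_3 -> R) :
  \sum_(a < #|{: pairs}|) F (enum_val a).1 (enum_val a).2 = \sum_i \sum_j F i j.
Proof.
rewrite pair_big /=; rewrite [RHS](reindex (@enum_val _ {: pairs})) //=.
exact/onW_bij/enum_val_bij.
Qed.

Lemma unfold4_inj T U : unfold4 T = unfold4 U -> T = U.
Proof.
move=> /matrixP TU; apply/ffunP; elim/tuple4_ind => i j k l _ _ _ _.
by have := TU (enum_rank (idx i, idx j)) (enum_rank (idx k, idx l));
  rewrite !mxE !enum_rankK.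
Qed.

Lemma unfold4_mul T U : unfold4 (mul4 T U) = unfold4 T *m unfold4 U.
Proof.
apply/matrixP => a b; rewrite !mxE ffunE -sum_pairs /=.
by apply: eq_bigr => c _; rewrite !mxE.
Qed.

Lemma unfold4_act g T : unfold4 (act4 g T) = kron g *m unfold4 T *m (kron g)^T.
Proof.
apply/matrixP => a b; rewrite mxE ffunE sum_tuple4.
transitivity (\sum_(c < #|{: pairs}|) \sum_(d < #|{: pairs}|)
  (g (enum_val a).1 (enum_val c).1 * g (enum_val a).2 (enum_val c).2) *
  (T [tuple (enum_val c).1; (enum_val c).2; (enum_val d).1; (enum_val d).2]) *
  (g (enum_val b).1 (enum_val d).1 * g (enum_val b).2 (enum_val d).2)).
  rewrite (sum_pairs (fun i j => \sum_(d < #|{: pairs}|)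
    (g (enum_val a).1 i * g (enum_val a).2 j) *
    (T [tuple i; j; (enum_val d).1; (enum_val d).2]) *
    (g (enum_val b).1 (enum_val d).1 * g (enum_val b).2 (enum_val d).2))).
  apply: eq_bigr => i _; apply: eq_bigr => j _.
  rewrite (sum_pairs (fun k l => (g (enum_val a).1 i * g (enum_val a).2 j) *
    T [tuple i; j; k; l] * (g (enum_val b).1 k * g (enum_val b).2 l))).
  apply: eq_bigr => k _; apply: eq_bigr => l _.
  rewrite !big_ord_recl big_ord0 !(tnth_nth 0) /=; ring.
rewrite [RHS]mxE exchange_big; apply: eq_bigr => d _.
rewrite [in RHS]mxE mulr_suml; apply: eq_bigr => c _.
by rewrite !mxE.
Qed.

Lemma kron_orthogonal g : g^T *m g = 1%:M -> (kron g)^T *m kron g = 1%:M.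
Proof.
move=> /matrixP gg; apply/matrixP => a b; rewrite !mxE.
transitivity ((g^T *m g) (enum_val a).1 (enum_val b).1 * (g^T *m g) (enum_val a).2
  (enum_val b).2).
  rewrite !mxE big_distrlr /=.
  rewrite -(sum_pairs (fun i j => g^T (enum_val a).1 i * g i (enum_val b).1 *
    (g^T (enum_val a).2 j * g j (enum_val b).2))).
  by apply: eq_bigr => c _; rewrite !mxE; ring.
rewrite !gg !mxE -natrM mulnb -[RHS]/((a == b)%:R) -(inj_eq enum_val_inj).
by case: (enum_val a) (enum_val b) => i j [k l].
Qed.

(** Unfolding turns [mul4] into the matrix product and the action into conjugation by the orthogonal
    matrix [kron g]. *)
Lemma act4_mul g T U : g^T *m g = 1%:M ->
  act4 g (mul4 T U) = mul4 (act4 g T) (act4 g U).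
Proof.
move=> /kron_orthogonal gg; apply: unfold4_inj; rewrite unfold4_mul !unfold4_act.
by rewrite unfold4_mul !mulmxA -[_ *m (kron g)^T *m kron g]mulmxA gg mulmx1.
Qed.

Lemma tr13_act g T : g^T *m g = 1%:M ->
  tr13 (act4 g T) = g *m tr13 T *m g^T.
Proof.
move=> /matrixP gg; apply/matrixP => i j; rewrite !mxE.
under eq_bigr => k _ do rewrite ffunE sum_tuple4.
rewrite exchange_big /=.
under eq_bigr => p _ do rewrite exchange_big /=.
transitivity (\sum_(p < 3) \sum_(q < 3) \sum_(r < 3) \sum_(s < 3)
  (p == r)%:R * (g i q * g j s * T [tuple p; q; r; s])).
  apply: eq_bigr => p _; apply: eq_bigr => q _.
  rewrite exchange_big /=; apply: eq_bigr => r _.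
  rewrite exchange_big /=; apply: eq_bigr => s _.
  have := gg p r; rewrite !mxE => <-; rewrite mulr_suml; apply: eq_bigr => k _.
  by rewrite !big_ord_recl big_ord0 !(tnth_nth 0) /= !mxE; ring.
transitivity (\sum_(q < 3) \sum_(s < 3) g i q * g j s * tr13 T q s).
  rewrite exchange_big /=; apply: eq_bigr => q _; rewrite exchange_big /=.
  under eq_bigr => r _ do rewrite exchange_big /=.
  rewrite exchange_big /=; apply: eq_bigr => s _; rewrite mxE mulr_sumr.
  apply: eq_bigr => p _; rewrite (bigD1 p) //= eqxx mul1r big1 ?addr0 //.
  by move=> r /negPf rp; rewrite rp mul0r.
rewrite exchange_big /=; apply: eq_bigr => s _; rewrite !mxE mulr_suml.
by apply: eq_bigr => q _; ring.
Qed.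

Lemma orthoL (g : O3 R) : (val g)^T *m val g = 1%:M.
Proof. by apply: mulmx1C; apply/eqP; exact: (valP g). Qed.

Lemma d2_act (g : O3 R) H : d2 (actH g H) = val g *m d2 H *m (val g)^T.
Proof. by rewrite /d2 /= -act4_mul ?tr13_act ?orthoL. Qed.

Lemma d3_act (g : O3 R) H : d3 (actH g H) = val g *m d3 H *m (val g)^T.
Proof. by rewrite /d3 /= -!act4_mul ?tr13_act ?orthoL. Qed.

Lemma octavic_invariant (k : 'I_9) : O3_invariant (tnth (octavic R) k).
Proof.
move=> g H; have gg := orthoL g; set q := val g in gg.
have sq (M : 'M[R]_3) : M ^+ 2 = M *m M by rewrite expr2.
have cube (M : 'M[R]_3) : M ^+ 3 = M *m (M *m M) by rewrite exprS expr2.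
have conjM (M N : 'M[R]_3) : q *m M *m q^T *m (q *m N *m q^T) = q *m (M *m N) *m q^T.
  by rewrite !mulmxA -[_ *m q^T *m q]mulmxA gg mulmx1.
have conj_tr (M : 'M[R]_3) : \tr (q *m M *m q^T) = \tr M.
  by rewrite mxtrace_mulC mulmxA gg mul1mx.
rewrite !(tnth_nth (@I2 R)); case: k => [[|[|[|[|[|[|[|[|[|k]]]]]]]]] ?] //;
  rewrite [LHS]/= [RHS]/= ?/I2 ?/I3 ?/I4 ?/I5 ?/I6 ?/I7 ?/I8 ?/I9 ?/I10;
  by rewrite ?d2_act ?d3_act -?/q ?cube ?sq ?conjM conj_tr.
Qed.

End Equivariance.

(** * Infinitesimal rotations *)

Section InfiniteField.
Context (K : numFieldType).

Lemma poly_vanish (p : {poly K}) : (forall a, p.[a] = 0) -> p = 0.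
Proof.
move=> p0; apply/eqP; apply: contraT => pn0.
have := @max_poly_roots _ p [seq i%:R | i <- iota 0 (size p)] pn0.
rewrite size_map size_iota ltnn; apply.
  by apply/allP => x _; apply/eqP/p0.
by rewrite map_inj_uniq ?iota_uniq // => i j /eqP; rewrite eqr_nat => /eqP.
Qed.

Lemma coef1_mmap (n : nat) (h : 'I_n -> {poly K}) (p : {mpoly K[n]}) :
  (mmap (@polyC K) h p)`_1 =
  \sum_i (p^`M(i)).@[fun j => (h j)`_0] * (h i)`_1.
Proof.
have coef1M (u v : {poly K}) : (u * v)`_1 = u`_0 * v`_1 + u`_1 * v`_0.
  by rewrite coefM !big_ord_recl big_ord0 addr0.
have ev q : (mmap (@polyC K) h q)`_0 = q.@[fun j => (h j)`_0].
  rewrite -horner_coef0 -[LHS]/(horner_eval 0 (mmap (@polyC K) h q)) rmorph_mmap.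
  by apply: eq_mmap => [c|i] /=; rewrite /horner_eval ?hornerC ?horner_coef0.
elim/mpoly_ring_ind: p => [c|i|p q IHp IHq|p q IHp IHq].
- rewrite mmapC coefC /= big1 // => i _; by rewrite mderivC meval0 mul0r.
- rewrite mmapX mmap1U (bigD1 i) //= big1 ?addr0 => [|j /negPf ji].
    by rewrite mderivXU eqxx rmorph1 mul1r.
  by rewrite mderivXU eq_sym ji meval0 mul0r.
- rewrite mmapD coefD IHp IHq -big_split; apply: eq_bigr => i _ /=.
  by rewrite mderivD mevalD mulrDl.
have [u pu] : exists u, u = p.@[fun j => (h j)`_0] by eexists.
have [v qv] : exists v, v = q.@[fun j => (h j)`_0] by eexists.
rewrite rmorphM coef1M IHp IHq !ev -pu -qv.
rewrite [u * _]mulr_sumr [_ * v]mulr_suml -big_split.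
apply: eq_bigr => i _ /=; rewrite mderivM mevalD !mevalM -pu -qv; ring.
Qed.

(** Induction on the degree: the value of a partial derivative at [v] is the linear coefficient of
    [p] on a line through [v], hence zero. All partial derivatives then vanish, and in
    characteristic zero [p] is constant. *)
Lemma mpoly_vanish (n : nat) (p : {mpoly K[n]}) : (forall v, p.@[v] = 0) -> p = 0.
Proof.
have: forall m, p@_m != 0 -> (mdeg m < msize p)%N.
  by move=> m; rewrite -mcoeff_msupp; apply: msize_mdeg_lt.
move: (msize p) => k; elim: k p => [|k IH] p pk p0.
  by apply/mpolyP => m; rewrite mcoeff0; apply/eqP; apply: contraT => /pk.
have dp i : p^`M(i) = 0.
  apply: IH => [m|v].
    rewrite mcoeff_mderiv => pm; have /pk : p@_(m + U_(i)) != 0.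
      by apply: contra pm => /eqP ->; rewrite mul0rn.
    by rewrite mdegD mdeg1 addn1 ltnS.
  have : mmap (@polyC K) (fun j => (v j)%:P + (i == j)%:R *: 'X) p = 0.
    apply: poly_vanish => a; rewrite -[LHS]/(horner_eval a _) rmorph_mmap.
    rewrite -[RHS](p0 (fun j => v j + (i == j)%:R * a)); apply: eq_mmap => [c|j] /=;
      by rewrite /horner_eval !hornerE.
  move/(congr1 (fun q : {poly K} => q`_1)); rewrite coef1_mmap coef0 (bigD1 i) //=.
  rewrite big1 ?addr0 => [|j /negPf ji]; last first.
    by rewrite eq_sym ji scale0r addr0 coefC mulr0.
  rewrite eqxx scale1r coefD coefC coefX add0r mulr1 => <-.
  apply: meval_eq => j; by rewrite coefD coefC coefZ coefX mulr0 addr0.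
have pm m : m != 0%MM -> p@_m = 0.
  move=> m0; have [i mi] : exists i, m i != 0%N.
    apply/existsP; rewrite -negb_forall; apply: contra m0 => /forallP m0.
    by apply/eqP/mnmP => i; rewrite mnm0E; apply/eqP.
  have := congr1 (mcoeff (m - U_(i))%MM) (dp i).
  rewrite mcoeff0 mcoeff_mderiv submK ?lep1mP // => /eqP.
  by rewrite -mulr_natr mulf_eq0 pnatr_eq0 orbF => /eqP.
have pE : p = (p@_0%MM)%:MP.
  apply/mpolyP => m; rewrite mcoeffC; case: eqP => [->|/eqP/pm ->];
    by rewrite ?mulr1 ?mulr0.
have c0 : p@_0%MM = 0 by have := p0 (fun=> 0); rewrite {1}pE mevalC.
by rewrite pE c0 mpolyC0.
Qed.

End InfiniteField.

(* The derivative at the identity, on the [T_ijkl], of the rotations in the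
   plane of the axes [a] and [b]. *)
Definition rotate_index (K : pzRingType) (a b : nat) (F : nat -> K) (i : nat) : K :=
  if i == a then F b else if i == b then - F a else 0.

Definition rotate4 (K : pzRingType) (a b : nat) (T : nat -> nat -> nat -> nat -> K)
    (i j k l : nat) : K :=
  rotate_index a b (fun p => T p j k l) i + rotate_index a b (fun p => T i p k l) j +
  rotate_index a b (fun p => T i j p l) k + rotate_index a b (fun p => T i j k p) l.

(** The indices are those of [coord_idx], kept in [nat] so that the same coordinates can be read off
    tensors with entries of any type. *)
Definition coord_entries (K : Type) (T : nat -> nat -> nat -> nat -> K) (k : nat) : K :=
  let b := if (k < 5)%N then k else (k - 5)%N in
  let c := (4 < k)%N in
  let f a := ((4 <= a + b + c)%N + (4 <= a + c)%N)%N in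
  T (f 0%N) (f 1%N) (f 2%N) (f 3%N).

Definition rotation (K : pzRingType) (a b : nat) (x : nat -> K) (k : nat) : K :=
  coord_entries (rotate4 a b (tensor_of (ring_arith K) x)) k.

Section Rotations.
Context (R : realType) (a b : nat).
Hypothesis ab : (a, b) \in [:: (0, 1); (2, 0); (2, 1)]%N.

(* [1 + 'X^2] times the matrix of a rotation of cosine [(1 - 'X^2) / (1 + 'X^2)]
   in the plane of the axes [a] and [b]. *)
Definition rotation_entry (i j : nat) : {poly R} :=
  ((i == j)%:R) * (1 + 'X^2) + ((i == a) && (j == b))%:R *: ('X *+ 2)
  - ((i == b) && (j == a))%:R *: ('X *+ 2)
  - ((i == j) && (i \in [:: a; b]))%:R *: ('X^2 *+ 2).

Definition rotation_at (s : R) : 'M[R]_3 := \matrix_(i, j) (rotation_entry i j).[s].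

Lemma rotation_atE s : rotation_at s *m (rotation_at s)^T = ((1 + s ^+ 2) ^+ 2)%:M.
Proof.
move: ab; rewrite !inE => /or3P[] /eqP [aE bE];
apply/matrixP => i j; rewrite !mxE !big_ord_recl big_ord0 !mxE /rotation_entry aE bE;
case: i => [[|[|[|i]]] ?] //; case: j => [[|[|[|j]]] ?] //;
rewrite !inE /= !hornerE /=; ring.
Qed.

Definition rotation_curve (T : nat -> nat -> nat -> nat -> R) (i j k l : nat)
  : {poly R} :=
  \sum_(p < 3) rotation_entry i p * (\sum_(q < 3) rotation_entry j q *
    (\sum_(r < 3) rotation_entry k r * (\sum_(w < 3) rotation_entry l w *
      (T p q r w)%:P))).

(** The parameter is the tangent of half the angle, so to first order it rotates by twice its value;
    hence the factor 2 in all linear coefficients. *)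
Lemma rotation_entry_coef i j : (rotation_entry i j)`_0 = (i == j)%:R /\
  (rotation_entry i j)`_1 = (((i == a) && (j == b))%:R - ((i == b) && (j == a))%:R) *+ 2.
Proof.
by split; rewrite /rotation_entry !(coefD, coefB, coefN, coefZ, coefMn, coefX,
  coefXn, coefM, big_ord_recl, big_ord0, coefE) /=;
  case: (i == j) => /=; rewrite ?coefE /=; ring.
Qed.

Lemma coef_rotation_sum (F : nat -> {poly R}) (i : nat) : (i < 3)%N ->
  (\sum_(p < 3) rotation_entry i p * F p)`_0 = (F i)`_0 /\
  (\sum_(p < 3) rotation_entry i p * F p)`_1 =
     (F i)`_1 + rotate_index a b (fun p => (F p)`_0) i *+ 2.
Proof.
move=> i3; have c0 p := proj1 (rotation_entry_coef i p);
  have c1 p := proj2 (rotation_entry_coef i p).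
have M0 p : (rotation_entry i p * F p)`_0 = (i == p)%:R * (F p)`_0.
  by rewrite coefM !big_ord_recl big_ord0 addr0 c0.
have M1 p : (rotation_entry i p * F p)`_1 = (i == p)%:R * (F p)`_1 +
    (((i == a) && (p == b))%:R - ((i == b) && (p == a))%:R) *+ 2 * (F p)`_0.
  by rewrite coefM !big_ord_recl big_ord0 addr0 c0 c1.
rewrite !coef_sum; split.
  rewrite !big_ord_recl big_ord0 !M0.
  by case: i i3 {c0 c1 M0 M1} => [|[|[|i]]] //= _; ring.
rewrite !big_ord_recl big_ord0 !M1 /rotate_index; move: ab; rewrite !inE.
by move=> /or3P[] /eqP [-> ->]; case: i i3 {c0 c1 M0 M1} => [|[|[|i]]] //= _; ring.
Qed.

Lemma coef_rotation_curve T i j k l :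
  (i < 3)%N -> (j < 3)%N -> (k < 3)%N -> (l < 3)%N ->
  (rotation_curve T i j k l)`_0 = T i j k l /\
  (rotation_curve T i j k l)`_1 = rotate4 a b T i j k l *+ 2.
Proof.
move=> i3 j3 k3 l3; rewrite /rotation_curve /rotate4.
have L p q r := coef_rotation_sum (fun w => (T p q r w)%:P) l3.
have K p q := coef_rotation_sum (fun r => \sum_(w < 3) rotation_entry l w *
  (T p q r w)%:P) k3.
have J p := coef_rotation_sum (fun q => \sum_(r < 3) rotation_entry k r *
  (\sum_(w < 3) rotation_entry l w * (T p q r w)%:P)) j3.
have [-> ->] := coef_rotation_sum (fun p => \sum_(q < 3) rotation_entry j q *
  (\sum_(r < 3) rotation_entry k r * (\sum_(w < 3) rotation_entry l w *
    (T p q r w)%:P))) i3.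
have E F G m : (forall p, F p = G p) -> rotate_index a b F m = rotate_index a b G m :> R.
  by move=> FG; rewrite /rotate_index !FG.
have J0 p : (\sum_(q < 3) rotation_entry j q * (\sum_(r < 3) rotation_entry k r *
    (\sum_(w < 3) rotation_entry l w * (T p q r w)%:P)))`_0 = T p j k l.
  by rewrite (proj1 (J _)) (proj1 (K _ _)) (proj1 (L _ _ _)) coefC.
have K0 p q : (\sum_(r < 3) rotation_entry k r *
    (\sum_(w < 3) rotation_entry l w * (T p q r w)%:P))`_0 = T p q k l.
  by rewrite (proj1 (K _ _)) (proj1 (L _ _ _)) coefC.
have L0 p q r : (\sum_(w < 3) rotation_entry l w * (T p q r w)%:P)`_0 = T p q r l.
  by rewrite (proj1 (L _ _ _)) coefC.
split; first exact: J0.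
rewrite (proj2 (J _)) (proj2 (K _ _)) (proj2 (L _ _ _)) coefC add0r.
rewrite (E _ _ _ J0) (E _ _ _ (K0 i)) (E _ _ _ (L0 i j)).
rewrite (E (fun p => (T i j k p)%:P`_0) (fun p => T i j k p)) => [|p];
  last by rewrite coefC.
by rewrite -!mulrnDl [in RHS]addrC !addrA; congr (_ *+ 2); ring.
Qed.

Lemma horner_rotation_curve (x : nat -> R) s (i j k l : nat) :
  (i < 3)%N -> (j < 3)%N -> (k < 3)%N -> (l < 3)%N ->
  (rotation_curve (tensor_of (ring_arith R) x) i j k l).[s] =
  act4 (rotation_at s) (tensor_coords x) [tuple idx i; idx j; idx k; idx l].
Proof.
have vidx (m : nat) : (m < 3)%N -> idx m = m :> nat by case: m => [|[|[|m]]].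
move=> i3 j3 k3 l3; rewrite ffunE sum_tuple4 /rotation_curve horner_sum.
apply: eq_bigr => p _; rewrite hornerM horner_sum mulr_sumr.
apply: eq_bigr => q _; rewrite hornerM horner_sum !mulr_sumr.
apply: eq_bigr => r _; rewrite hornerM horner_sum !mulr_sumr.
apply: eq_bigr => w _; rewrite hornerM hornerC tensor_coordsE.
rewrite !big_ord_recl big_ord0 !(tnth_nth 0) /= !mxE !vidx //; ring.
Qed.

End Rotations.

Lemma coord_idxE k : coord_idx k = coord_entries (fun i j k l => [tuple idx i; idx j;
  idx k; idx l]) k.
Proof. by rewrite /coord_idx /coord_entries; case: ltnP. Qed.

Lemma coord_of_coords (R : realType) (x : nat -> R) k : (k < 9)%N ->
  coord (of_coords x) k = x k.
Proof.
by case: k => [|[|[|[|[|[|[|[|[|k]]]]]]]]] //= _; rewrite /coord /= ffunE.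
Qed.

Lemma coord_entriesP k : exists i j l m, [/\ i < 3, j < 3, l < 3 & m < 3]%N /\
  forall (K : Type) (T : nat -> nat -> nat -> nat -> K), coord_entries T k = T i j l m.
Proof.
pose f (a : nat) := ((4 <= a + (if (k < 5)%N then k else (k - 5)%N) + (4 < k)%N)%N +
  (4 <= a + (4 < k)%N)%N)%N.
have f3 a : (f a < 3)%N by rewrite /f; case: (4 <= _)%N; case: (4 <= _)%N.
by exists (f 0%N), (f 1%N), (f 2%N), (f 3%N).
Qed.

Lemma rmorph_rotation (K S : pzRingType) (f : {rmorphism K -> S}) a b x k :
  f (rotation a b x k) = rotation a b (f \o x) k.
Proof.
have fT i j l m : f (tensor_of (ring_arith K) x i j l m) = tensor_of
  (ring_arith S) (f \o x) i j l m.
  rewrite /tensor_of; move: (count_mem _ _) (count_mem _ _) => p q.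
  by case: p q => [|[|[|[|p]]]] q; case: q => [|[|[|[|q]]]] /=; rewrite ?rmorphN ?rmorphD.
have fR F i : f (rotate_index a b F i) = rotate_index a b (f \o F) i.
  by rewrite /rotate_index; case: ifP => // _; case: ifP; rewrite ?rmorphN ?rmorph0.
rewrite /rotation; have [i [j [l [m [_ E]]]]] := coord_entriesP k; rewrite !E.
rewrite /rotate4 !rmorphD !fR.
by congr (_ + _ + _ + _); rewrite /rotate_index /= !fT.
Qed.

Lemma eq_rotation (K : pzRingType) a b (x y : nat -> K) k : x =1 y ->
  rotation a b x k = rotation a b y k.
Proof.
move=> xy; have E i j l m : tensor_of (ring_arith K) x i j l m = tensor_of
  (ring_arith K) y i j l m.
  by rewrite /tensor_of /component; case: (count_mem 2%N _) => [|[|[|[|?]]]]; rewrite !xy.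
rewrite /rotation; have [i [j [l [m [_ F]]]]] := coord_entriesP k; rewrite !F.
by rewrite /rotate4 /rotate_index !E.
Qed.

(** * Annihilation of homogeneous invariants by infinitesimal rotations *)

Lemma dhomog_evalZ (K : comNzRingType) (n d : nat) (p : {mpoly K[n]}) c v :
  p \is d.-homog -> p.@[fun i => c * v i] = c ^+ d * p.@[v].
Proof.
move=> /dhomogP hp; rewrite !mevalE mulr_sumr big_seq [RHS]big_seq.
apply: eq_bigr => m mp; rewrite -(hp m mp) mulrCA; congr (_ * _).
rewrite /= mdegE -prodrXr -big_split; apply: eq_bigr => i _.
by rewrite /= exprMn.
Qed.

Section InfinitesimalInvariance.
Context (R : realType).

Definition coord_eval (P : {mpoly R[9]}) (H : H4 R) : R := P.@[fun i => coord H i].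

Definition homogeneous_invariant (d : nat) (P : {mpoly R[9]}) : Prop :=
  P \is d.-homog /\ O3_invariant (coord_eval P).

(** Along the rescaled rotation curve through [v], the polynomial [P] takes the value
    [(1 + s^2)^(4 d) P(v)], which has no linear term in [s]. By the chain rule that term is twice
    the derivative of [P] along the rotation. *)
Lemma rotation_identity a b d P : (a, b) \in [:: (0, 1); (2, 0); (2, 1)]%N ->
  homogeneous_invariant d P -> lder (fun i : 'I_9 => rotation a b (var R) i) P = 0.
Proof.
move=> ab [hP invP]; apply: mpoly_vanish => v.
pose x k := (var R k).@[v].
have xE (i : 'I_9) : x i = v i by rewrite /x /var ltn_ord mevalXU inord_val.
pose T := tensor_of (ring_arith R) x.
pose c k := coord_entries (rotation_curve a b T) k.
pose Q := mmap (@polyC R) (fun i : 'I_9 => c i) P.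
have c01 k : (k < 9)%N -> (c k)`_0 = x k /\ (c k)`_1 = rotation a b x k *+ 2.
  move=> k9; have [i [j [l [m [[i3 j3 l3 m3] E]]]]] := coord_entriesP k.
  have [c0 c1] := coef_rotation_curve ab T i3 j3 l3 m3.
  rewrite /c E c0 c1 /rotation E; split=> //.
  rewrite -(coord_of_coords x k9) /coord coord_idxE E tensor_coordsE.
  by have vidx n : (n < 3)%N -> idx n = n :> nat by [case: n => [|[|[|n]]]];
     rewrite !vidx.
have Q1 : Q`_1 = (lder (fun i : 'I_9 => rotation a b (var R) i) P).@[v] *+ 2.
  rewrite coef1_mmap lderE raddf_sum -sumrMnl; apply: eq_bigr => i _ /=.
  have [_ ->] := c01 i (ltn_ord i).
  rewrite mevalM rmorph_rotation mulrC mulrnAl; congr (_ * _ *+ 2).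
  by apply: meval_eq => j; have [-> _] := c01 j (ltn_ord j); rewrite xE.
(* Each component of the tensor carries four factors [1 + 'X^2], one for each index, and homogeneity
   raises them to the power [d]. *)
have QE : Q = (1 + 'X^2) ^+ (4 * d) * (P.@[v])%:P.
  apply/eqP; rewrite -subr_eq0; apply/eqP; apply: poly_vanish => s.
  apply/eqP; rewrite hornerD hornerN subr_eq0 hornerM hornerC horner_exp !hornerE;
    apply/eqP.
  have s0 : 1 + s ^+ 2 != 0 by rewrite gt_eqF // ltr_pwDl // sqr_ge0.
  pose M := (1 + s ^+ 2)^-1 *: rotation_at a b s.
  have MO : M *m M^T == 1%:M.
    rewrite /M linearZ /= -scalemxAl -scalemxAr rotation_atE // scalerA -invfM.
    by rewrite scale_scalar_mx -expr2 mulVf // expf_neq0.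
  pose g : O3 R := exist (fun g : 'M[R]_3 => g *m g^T == 1%:M) M MO.
  have -> : Q.[s] = P.@[fun i : 'I_9 => (c i).[s]].
    rewrite /Q -[LHS]/(horner_eval s _) rmorph_mmap; apply: eq_mmap => [e|i] //=.
    by rewrite /horner_eval hornerC.
  have cE (i : 'I_9) : (c i).[s] = (1 + s ^+ 2) ^+ 4 * coord (actH g (of_coords x)) i.
    have [i' [j [l [m [[i3 j3 l3 m3] E]]]]] := coord_entriesP i.
    rewrite /c E horner_rotation_curve // /coord coord_idxE E /= !ffunE mulr_sumr.
    apply: eq_bigr => u _; rewrite mulrA; congr (_ * _).
    rewrite !big_ord_recl !big_ord0 !mulr1 !mxE.
    by field.
  rewrite (meval_eq P cE) (dhomog_evalZ _ _ hP) exprM; congr (_ * _).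
  rewrite -[LHS]/(coord_eval P (actH g (of_coords x))) invP.
  by apply: meval_eq => i; rewrite coord_of_coords // xE.
have : Q`_1 = 0.
  rewrite QE; set q := (1 + 'X^2) ^+ _; rewrite mulrC coefCM.
  suff -> : q`_1 = 0 by rewrite mulr0.
  have := coef_deriv q 0; rewrite mulr1n => <-.
  rewrite -horner_coef0 /q deriv_exp derivD derivC derivXn add0r.
  by rewrite hornerMn hornerM hornerMn hornerXn expr1 mul0rn mul0r mul0rn.
by rewrite Q1 => /eqP; rewrite mulrn_eq0 => /eqP.
Qed.

End InfinitesimalInvariance.

(** * Weight vectors *)

(* With [e_+ = e_x + i e_y] and [e_- = e_x - i e_y], tracelessness gives
   [T(e_+^p e_-^q e_z^r) = (-1)^q z_(p - q)] for weight vectors [z_w]; expanding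
   [e_x = (e_+ + e_-) / 2] and [e_y = - i (e_+ - e_-) / 2] yields 16 times the
   coordinates.  The weight [w] has index [w + 4]. *)
Definition octavic_of_weights (S : pzRingType) (J : S) (z : nat -> S) (k : nat) : S :=
  match k with
  | 0 => z 8%N - 4%:R * z 6%N + 6%:R * z 4%N - 4%:R * z 2%N + z 0%N
  | 1 => - J * (z 8%N - 2%:R * z 6%N + 2%:R * z 2%N - z 0%N)
  | 2 => - (z 8%N - 2%:R * z 4%N + z 0%N)
  | 3 => J * (z 8%N + 2%:R * z 6%N - 2%:R * z 2%N - z 0%N)
  | 4 => z 8%N + 4%:R * z 6%N + 6%:R * z 4%N + 4%:R * z 2%N + z 0%N
  | 5 => 2%:R * (z 7%N - 3%:R * z 5%N + 3%:R * z 3%N - z 1%N)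
  | 6 => - 2%:R * J * (z 7%N - z 5%N - z 3%N + z 1%N)
  | 7 => - 2%:R * (z 7%N + z 5%N - z 3%N - z 1%N)
  | 8 => 2%:R * J * (z 7%N + 3%:R * z 5%N + 3%:R * z 3%N + z 1%N)
  | _ => 0
  end.

(* [z_w = T(e_+^w e_z^(4 - w))] and [z_(- w) = (-1)^w T(e_-^w e_z^(4 - w))]. *)
Definition weights_of_octavic (S : pzRingType) (J : S) (x : nat -> S) (k : nat) : S :=
  let t := component (ring_arith S) x in
  match k with
  | 0 => t 0%N 0%N - 4%:R * J * t 1%N 0%N - 6%:R * t 2%N 0%N + 4%:R * J
    * t 3%N 0%N + t 4%N 0%N
  | 1 => - (t 0%N 1%N - 3%:R * J * t 1%N 1%N - 3%:R * t 2%N 1%N + J * t 3%N 1%N)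
  | 2 => t 0%N 2%N - 2%:R * J * t 1%N 2%N - t 2%N 2%N
  | 3 => - (t 0%N 3%N - J * t 1%N 3%N)
  | 4 => t 0%N 4%N
  | 5 => t 0%N 3%N + J * t 1%N 3%N
  | 6 => t 0%N 2%N + 2%:R * J * t 1%N 2%N - t 2%N 2%N
  | 7 => t 0%N 1%N + 3%:R * J * t 1%N 1%N - 3%:R * t 2%N 1%N - J * t 3%N 1%N
  | 8 => t 0%N 0%N + 4%:R * J * t 1%N 0%N - 6%:R * t 2%N 0%N - 4%:R * J
    * t 3%N 0%N + t 4%N 0%N
  | _ => 0
  end.

Lemma octavic_of_weightsK (S : comNzRingType) (J : S) x k : J * J = -1 -> (k < 9)%N ->
  octavic_of_weights J (weights_of_octavic J x) k = 16%:R * x k.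
Proof.
move=> JJ; case: k => [|[|[|[|[|[|[|[|[|k]]]]]]]]] //= _; by ring: JJ.
Qed.

Lemma rmorph_octavic_of_weights (S U : pzRingType) (f : {rmorphism S -> U}) J z k :
  f (octavic_of_weights J z k) = octavic_of_weights (f J) (f \o z) k.
Proof.
by case: k => [|[|[|[|[|[|[|[|[|k]]]]]]]]] /=;
  rewrite ?(rmorphB, rmorphD, rmorphN, rmorphM, rmorph_nat, rmorph0) ?rmorph1.
Qed.

Lemma eq_octavic_of_weights (S : pzRingType) (J : S) z z' k :
  (forall i, (i < 9)%N -> z i = z' i) ->
  octavic_of_weights J z k = octavic_of_weights J z' k.
Proof. by move=> zz; case: k => [|[|[|[|[|[|[|[|[|k]]]]]]]]] /=; rewrite ?zz. Qed.

(** Matches the sl2 operator with a complex combination of infinitesimal rotations. The scalar [c]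
    stands for the 1/16 that normalizes [octavic_of_weights]. *)
Lemma raise_rotation (S : comNzRingType) (c J : S) z k : J * J = -1 -> (k < 9)%N ->
  c * octavic_of_weights J (fun i => (8%:R - i%:R) * z i.+1) k =
  rotation 2 0 (fun i => c * octavic_of_weights J z i) k +
  J * rotation 2 1 (fun i => c * octavic_of_weights J z i) k.
Proof.
move=> JJ; rewrite /rotation /coord_entries /rotate4 /rotate_index /tensor_of.
by case: k => [|[|[|[|[|[|[|[|[|k]]]]]]]]] //= _; ring: JJ.
Qed.

Lemma weigh_rotation (S : comNzRingType) (c J : S) z k : J * J = -1 -> (k < 9)%N ->
  c * octavic_of_weights J (fun i => (i%:R - 4%:R) * z i) k =
  J * rotation 0 1 (fun i => c * octavic_of_weights J z i) k.
Proof.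
move=> JJ; rewrite /rotation /coord_entries /rotate4 /rotate_index /tensor_of.
by case: k => [|[|[|[|[|[|[|[|[|k]]]]]]]]] //= _; ring: JJ.
Qed.

Section WeightVectors.
Context (K : numFieldType) (I : K).
Hypothesis II : I * I = -1.
Local Notation C := (@mpolyC 9 K).

Definition octavic_form (k : nat) : {mpoly K[9]} :=
  (16%:R^-1)%:MP * octavic_of_weights I%:MP (var K) k.

Definition weight_form (k : nat) : {mpoly K[9]} :=
  weights_of_octavic I%:MP (var K) k.

Definition to_weights : {mpoly K[9]} -> {mpoly K[9]} :=
  mmap C (fun i : 'I_9 => octavic_form i).

Let JJ : I%:MP * I%:MP = -1 :> {mpoly K[9]}.
Proof. by rewrite -mpolyCM II mpolyCN. Qed.

Lemma to_weightsK p : mmap C (fun i : 'I_9 => weight_form i) (to_weights p) = p.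
Proof.
rewrite /to_weights mmap_comp -[RHS]mmap_id; apply: eq_mmap => // i.
pose phi := mmap C (fun i : 'I_9 => weight_form i).
have phiC c : phi c%:MP = c%:MP by exact: mmapC.
transitivity ((16%:R^-1)%:MP * octavic_of_weights I%:MP (phi \o var K) i).
  rewrite -(phiC 16%:R^-1) -(phiC I) -(rmorph_octavic_of_weights phi).
  exact: rmorphM.
have -> : octavic_of_weights I%:MP (phi \o var K) i =
    octavic_of_weights I%:MP (weights_of_octavic I%:MP (var K)) i.
  have E k : (k < 9)%N -> (phi \o var K) k = weights_of_octavic I%:MP (var K) k.
    by move=> k9; rewrite /= /var k9 /phi mmapX mmap1U inordK.
  exact: eq_octavic_of_weights.
rewrite octavic_of_weightsK // mulrA.
have -> : 16%:R = 16%:R%:MP :> {mpoly K[9]} by rewrite rmorph_nat.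
by rewrite -mpolyCM mulVf ?pnatr_eq0 // mpolyC1 mul1r /var ltn_ord inord_val.
Qed.

Lemma to_weightsD p q : to_weights (p + q) = to_weights p + to_weights q.
Proof. exact: rmorphD. Qed.

Lemma to_weightsM p q : to_weights (p * q) = to_weights p * to_weights q.
Proof. exact: rmorphM. Qed.

Lemma to_weightsC c : to_weights c%:MP = c%:MP.
Proof. exact: mmapC. Qed.

Lemma to_weights_inj : injective to_weights.
Proof. exact: can_inj to_weightsK. Qed.

(** Two derivations that correspond under a substitution on the variables correspond on all
    polynomials, by the chain rule. *)
Lemma lder_to_weights (e c : 'I_9 -> {mpoly K[9]}) p :
  (forall i : 'I_9, lder e (octavic_form i) = to_weights (c i)) ->
  lder e (to_weights p) = to_weights (lder c p).
Proof.
move=> ec; rewrite lder_mmap lderE [RHS]rmorph_sum; apply: eq_bigr => i _.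
by rewrite [RHS]rmorphM ec mulrC.
Qed.

Lemma to_weights_rotation a b k :
  to_weights (rotation a b (var K) k) = rotation a b (octavic_form) k.
Proof.
rewrite [LHS](rmorph_rotation (mmap C (fun i : 'I_9 => octavic_form i))).
apply: eq_rotation => i /=; rewrite /var; case: ltnP => i9.
  by rewrite mmapX mmap1U inordK.
rewrite mmap0 /octavic_form.
by case: i i9 => [|[|[|[|[|[|[|[|[|i]]]]]]]]] //= _; rewrite mulr0.
Qed.

Lemma lder_linear_form e k :
  lder e (octavic_form k) = (16%:R^-1)%:MP * octavic_of_weights I%:MP
    (fun i => lder e (var K i)) k.
Proof.
have eC c p : lder e (c%:MP * p) = c%:MP
  * lder e p by rewrite mul_mpolyC lderZ -mul_mpolyC.
have en m p : lder e (m%:R * p) = m%:R * lder e p.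
  by rewrite -(rmorph_nat (@mpolyC 9 K)) eC.
rewrite /octavic_form eC; congr (_ * _).
case: k => [|[|[|[|[|[|[|[|[|k]]]]]]]]] /=; rewrite ?raddf0 ?mulNr -?mulrA;
  by do 5 rewrite ?(raddfN, eC, en, raddfD, raddfB) /=.
Qed.


Lemma raise_octavic_form k : (k < 9)%N -> raise (octavic_form k) =
  to_weights (rotation 2 0 (var K) k + I%:MP * rotation 2 1 (var K) k).
Proof.
move=> k9; rewrite to_weightsD to_weightsM to_weightsC !to_weights_rotation.
rewrite -raise_rotation // /raise lder_linear_form; congr (_ * _).
apply: eq_octavic_of_weights => i i9; rewrite /var i9 lderX inordK //.
have [->|i8] := eqVneq i 8%N; first by rewrite !subrr scale0r mul0r.
rewrite ifT; last by lia.
by rewrite -mul_mpolyC rmorphB /= -!pmulrn mpolyCB !rmorph_nat.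
Qed.

Lemma weigh_octavic_form k : (k < 9)%N -> weigh (octavic_form k) =
  to_weights (I%:MP * rotation 0 1 (var K) k).
Proof.
move=> k9; rewrite to_weightsM to_weightsC to_weights_rotation.
rewrite -weigh_rotation // /weigh lder_linear_form; congr (_ * _).
apply: eq_octavic_of_weights => i i9; rewrite /var i9 lderX inordK //.
by rewrite -mul_mpolyC rmorphB /= -!pmulrn mpolyCB !rmorph_nat.
Qed.

Lemma euler_octavic_form k : (k < 9)%N -> euler (octavic_form k) = octavic_form k.
Proof.
move=> k9; rewrite /euler lder_linear_form; congr (_ * _).
by apply: eq_octavic_of_weights => i i9; rewrite /var i9 lderX scale1r.
Qed.

(** In weight coordinates [raise] and [weigh] become combinations of the three rotations, which
    annihilate [p]; the substitution is linear and so preserves the degree. *)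
Lemma to_weights_highest d p : p \is d.-homog ->
  (forall a b, (a, b) \in [:: (0, 1); (2, 0); (2, 1)]%N ->
    lder (fun i : 'I_9 => rotation a b (var K) i) p = 0) ->
  weight_space d 0 (to_weights p) /\ raise (to_weights p) = 0.
Proof.
move=> hp rp.
have toZ c q : to_weights (c *: q) = c *: to_weights q.
  by rewrite /to_weights mmapZ mul_mpolyC.
have lderCl c (a : 'I_9 -> {mpoly K[9]}) : lder (fun i => c%:MP * a i) p = c *: lder a p.
  by rewrite -lderZl; apply: eq_lder => i; rewrite mul_mpolyC.
split; last first.
  rewrite /raise (lder_to_weights _ (c := fun i : 'I_9 =>
    rotation 2 0 (var K) i + I%:MP * rotation 2 1 (var K) i)); last first.
    by move=> i; rewrite -raise_octavic_form.
  have -> : lder (fun i : 'I_9 => rotation 2 0 (var K) i + I%:MP * rotation 2 1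
    (var K) i) p =
      lder (fun i : 'I_9 => rotation 2 0 (var K) i) p + I *: lder (fun i : 'I_9
        => rotation 2 1 (var K) i) p.
    by rewrite -lderCl !lderE -big_split; apply: eq_bigr => i _; rewrite mulrDl.
  by rewrite !rp // scaler0 addr0 /to_weights mmap0.
apply/weight_spaceP; split.
  rewrite /euler (lder_to_weights _ (c := fun i : 'I_9 => 'X_i)) => [|i]; last first.
    rewrite [LHS]euler_octavic_form // /to_weights mmapX mmap1U //.
  rewrite -toZ; congr to_weights; apply/mpolyP => m.
  rewrite (@eq_lder _ _ _ (fun i : 'I_9 => 1 *: 'X_i)) => [|i]; last by rewrite scale1r.
  rewrite mcoeff_lder_diag mcoeffZ;
    have [pm|/(dhomog_nemf_coeff hp) ->] := eqVneq (mdeg m) d; last by rewrite !mulr0.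
  rewrite -pm mdegE natr_sum; congr (_ * _).
  by apply: eq_bigr => i _; rewrite mul1r.
rewrite /weigh (lder_to_weights _ (c := fun i : 'I_9 => I%:MP * rotation 0 1 (var K) i)).
  by rewrite lderCl rp // scaler0 scale0r /to_weights mmap0.
by move=> i; rewrite -weigh_octavic_form.
Qed.

End WeightVectors.

(** * The dimension bound *)

Lemma map_mderiv (n : nat) (R S : nzRingType) (f : {rmorphism R -> S}) (i : 'I_n) p :
  map_mpoly f p^`M(i) = (map_mpoly f p)^`M(i).
Proof.
apply/mpolyP => m; rewrite mcoeff_map_mpoly !mcoeff_mderiv mcoeff_map_mpoly.
exact: (rmorphMn f).
Qed.

Lemma map_lder (n : nat) (R S : comNzRingType) (f : {rmorphism R -> S}) c (p
  : {mpoly R[n]}) :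
  map_mpoly f (lder c p) = lder (fun i => map_mpoly f (c i)) (map_mpoly f p).
Proof.
rewrite !lderE rmorph_sum; apply: eq_bigr => i _.
by rewrite rmorphM /= map_mderiv.
Qed.

Section Bound.
Context (R : realType).

(** Weight vectors require a square root of -1, so the polynomials are extended to [R[i]]; this and
    the injective [to_weights] preserve independence. *)
Lemma invariant_bound (n d : nat) (G : 'I_n -> {mpoly R[9]}) :
  (forall i, homogeneous_invariant d (G i)) -> independent G ->
  n%:Z <= count_standard d%:Z.
Proof.
move=> Ginv Gind; pose f : {rmorphism R -> R[i]} := real_complex R.
have II : 'i%C * 'i%C = -1 :> R[i] by rewrite -expr2 sqr_i.
pose G' i := to_weights 'i%C (map_mpoly f (G i)).
have hw i : weight_space d 0 (G' i) /\ raise (G' i) = 0.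
  have [hG _] := Ginv i; apply: to_weights_highest => // [|a b ab].
    have /dhomogP hG' := hG; apply/dhomogP => m mG; apply: hG'; move: mG.
    rewrite !mcoeff_msupp mcoeff_map_mpoly; apply: contra => /eqP ->.
    by apply/eqP; exact: (rmorph0 f).
  have := congr1 (map_mpoly f) (rotation_identity ab (Ginv i)).
  rewrite map_lder rmorph0 => E; rewrite -[RHS]E; apply: eq_lder => j.
  rewrite [RHS](rmorph_rotation (map_mpoly f)); apply: eq_rotation => k /=.
  by rewrite map_var.
have := highest_weight_bound (fun i => proj1 (hw i)) (fun i => proj2 (hw i)).
rewrite -count_octavic lerBrDr; apply=> c c0; apply: ((independent_map f G).2 Gind).
apply: (@to_weights_inj _ 'i%C II); rewrite [RHS]raddf0 -[RHS]c0 [LHS]raddf_sum.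
by apply: eq_bigr => i _; rewrite /= mmapZ mul_mpolyC.
Qed.

End Bound.

(** * Standard monomials *)

Definition weighted_degree (m : 'X_{1..9}) : nat := \sum_(i < 9) (i + 2) * m i.

Definition standard_mnm (e : nat * nat * nat) (s : seq nat) : 'X_{1..9} :=
  [multinom nth 0%N (s ++ [:: e.1.1; e.1.2; e.2]) i | i < 9].

Definition standard_mnms (d : nat) : seq 'X_{1..9} :=
  [seq standard_mnm b.1 s | b <- zip module_exponents module_degrees,
     s <- mons parameter_degrees (d%:Z - b.2%:Z) 0].

Lemma size_standard_mnms d : (size (standard_mnms d))%:Z = count_standard d%:Z.
Proof.
rewrite size_allpairs_dep sumnE big_map (big_morph _ PoszD (erefl _)).
by rewrite /count_standard /cnt !big_cons !big_nil.
Qed.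

Lemma tail_standard_mnm e s : size s = 6%N -> tail_mnm (standard_mnm e s) = e.
Proof.
case: e => [[a b] c] s6; rewrite /tail_mnm !mnmE !inordK //.
by rewrite !nth_cat s6.
Qed.

Lemma standard_mnmsP d m : m \in standard_mnms d -> standard m /\ weighted_degree m = d.
Proof.
case/allpairsPdep => b [s [bP]]; rewrite mem_mons // => /and3P[/eqP ss /eqP sd _] ->.
split.
  rewrite /standard tail_standard_mnm //.
  by move: bP; rewrite /= !inE => /or4P[|||/orP[]] /eqP ->.
apply/eqP; rewrite -eqz_nat /weighted_degree !big_ord_recl big_ord0 !mnmE.
move: ss sd bP; case: s => [|? [|? [|? [|? [|? [|? [|]]]]]]] //= _ sd.
by rewrite !inE => /or4P[|||/orP[]] /eqP bE; move: sd; rewrite bE /bump /= => sd;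
  apply/eqP; lia.
Qed.

Lemma uniq_standard_mnms d : uniq (standard_mnms d).
Proof.
apply: allpairs_uniq_dep => // [b _|]; first exact: uniq_mons.
move=> _ _ /allpairsPdep[[e k] [s [bP sP ->]]] /allpairsPdep[[e' k'] [s' [bP' sP'
  ->]]] /=.
have size6 (t : seq nat) l : t \in mons parameter_degrees l 0 -> size t = 6%N.
  by rewrite mem_mons // => /and3P[/eqP].
move: (size6 _ _ sP) (size6 _ _ sP') => s6 s6' E.
have ee : e = e' by rewrite -(tail_standard_mnm e s6) E tail_standard_mnm.
have kk : k = k'.
  move: bP bP'; rewrite -{}ee /= !inE.
  by do 4 (case/orP => [/eqP[-> ->]|]; first by
    do 4 (case/orP => [/eqP[]//|]); move=> /eqP[]); move=> /eqP[-> ->];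
    do 4 (case/orP => [/eqP[]//|]); move=> /eqP[].
rewrite -{}ee -{}kk; congr (Tagged _ _); apply: (@eq_from_nth _ 0%N);
  first by rewrite s6 s6'.
rewrite s6 => i i6; have i9 : (i < 9)%N by lia.
have := congr1 (fun m : 'X_{1..9} => m (Ordinal i9)) E.
by rewrite !mnmE !nth_cat s6 s6' /= i6.
Qed.

Lemma standard_of_degree m : (weighted_degree m <= 10)%N -> standard m.
Proof.
move=> m10; rewrite /standard /tail_mnm.
have : (8 * m (inord 6) + 9 * m (inord 7) + 10 * m (inord 8) <= 10)%N.
  apply: leq_trans m10; rewrite /weighted_degree.
  rewrite (bigD1 (inord 6)) //= (bigD1 (inord 7)) /=; last by rewrite -val_eqE /= !inordK.
  rewrite (bigD1 (inord 8)) /=; last by rewrite -!val_eqE /= !inordK.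
  by rewrite !inordK //; lia.
move: (m (inord 6)) (m (inord 7)) (m (inord 8)) => a b c abc.
have : [|| (a == 0%N) && (b == 0%N) && (c == 0%N), (a == 1%N) && (b == 0%N) && (c == 0%N),
   (a == 0%N) && (b == 1%N) && (c == 0%N) | (a == 0%N) && (b == 0%N) && (c
     == 1%N)] by lia.
by case/or4P => /andP[/andP[/eqP -> /eqP ->] /eqP ->].
Qed.

(** * The nine invariants as homogeneous polynomials *)

Section Homogeneity.
Context (R : comNzRingType).
Local Notation A := (ring_arith {mpoly R[9]}).

Lemma var_homog i : var R i \is 1.-homog.
Proof. rewrite /var; case: ifP => _; last exact: rpred0.
by rewrite dhomogX; apply/eqP; exact: mdeg1. Qed.

Lemma sum3_homog d (f : nat -> {mpoly R[9]}) :
  (forall i, f i \is d.-homog) -> sum3 A f \is d.-homog.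
Proof. by move=> fd; rewrite /sum3 /= !rpredD ?rpred0. Qed.

Lemma store_homog d (f : nat -> nat -> {mpoly R[9]}) :
  (forall i j, f i j \is d.-homog) -> forall i j, store A f i j \is d.-homog.
Proof.
by move=> fd [|[|[|i]]] [|[|[|j]]]; rewrite /store /= ?nth_nil ?rpred0.
Qed.

Lemma mul3_homog d e (f g : nat -> nat -> {mpoly R[9]}) :
  (forall i j, f i j \is d.-homog) -> (forall i j, g i j \is e.-homog) ->
  forall i j, mul3 A f g i j \is (d + e).-homog.
Proof.
by move=> fd ge; apply: store_homog => i j; apply: sum3_homog => k; apply: dhomogM.
Qed.

Lemma generator_homog k : generator R k \is (k + 2).-homog.
Proof.
have Th i j l m : tensor_of A (var R) i j l m \is 1.-homog.
  rewrite /tensor_of /component; case: (count_mem 2%N _) => [|[|[|[|?]]]] /=;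
    by rewrite ?rpredN ?rpredD ?var_homog.
have Qh i j l m : square_of A (var R) i j l m \is 2.-homog.
  by do 2 apply: sum3_homog => ?; apply: (dhomogM (d := 1) (e := 1)).
have h2 : forall i j, d2_of A (var R) i j \is 2.-homog.
  by apply: store_homog => i j; apply: sum3_homog.
have h3 : forall i j, d3_of A (var R) i j \is 3.-homog.
  by apply: store_homog => i j; do 3 apply: sum3_homog => ?;
    apply: (dhomogM (d := 2) (e := 1)).
have h4 := mul3_homog h2 h2; have h6 := mul3_homog h3 h3.
have tr d (f : nat -> nat -> {mpoly R[9]}) : (forall i j, f i j \is d.-homog) ->
    trace3 A f \is d.-homog.
  by move=> fd; apply: sum3_homog.
rewrite /generator; case: k => [[|[|[|[|[|[|[|[|[|k]]]]]]]]] ?] //.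
- exact: (tr 2 _ h2).
- exact: (tr 3 _ h3).
- exact: (tr 4 _ h4).
- exact: (tr 5 _ (mul3_homog h2 h3)).
- exact: (tr 6 _ (mul3_homog h2 h4)).
- exact: (tr 7 _ (mul3_homog h4 h3)).
- exact: (tr 8 _ (mul3_homog h2 h6)).
- exact: (tr 9 _ (mul3_homog h3 h6)).
exact: (tr 10 _ (mul3_homog h4 h6)).
Qed.

Lemma power_product_homog m : power_product R m \is (weighted_degree m).-homog.
Proof.
rewrite /power_product /mmap1 /weighted_degree.
elim/big_rec2: _ => [|i d p _ IH]; first exact: dhomog1.
by apply: dhomogM => //; apply: dhomogMn; apply: generator_homog.
Qed.

End Homogeneity.

(** * Generation and minimality *)

Section Generation.
Context (R : realType).
Local Notation C := (@mpolyC 9 R).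

Lemma eq_of_coords (x y : nat -> R) : (forall i, (i < 9)%N -> x i = y i) ->
  of_coords x = of_coords y.
Proof.
move=> xy; apply: val_inj; apply/ffunP => t; rewrite !ffunE.
move: (mult_idx_le4 t); move: (mult_idx 1 t) (mult_idx 2 t) => b c bc.
by rewrite /component; case: c bc => [|[|[|[|c]]]] bc; rewrite !xy //; lia.
Qed.

Lemma tensor_coordsZ (t : R) (x : nat -> R) u :
  tensor_coords (fun k => t * x k) u = t * tensor_coords x u.
Proof.
by rewrite !ffunE /component; case: (mult_idx 2 u) => [|[|[|[|?]]]] /=; ring.
Qed.

Lemma coord_var (H : H4 R) : of_coords (fun k => (var R k).@[fun i => coord H i]) = H.
Proof.
rewrite -[RHS]of_coordsK; apply: eq_of_coords => k k9.
by rewrite /var k9 mevalXU inordK.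
Qed.

Lemma generator_eval (k : 'I_9) H :
  (generator R k).@[fun i => coord H i] = tnth (octavic R) k H.
Proof.
rewrite /generator (rmorph_invariant (meval _)) -octavicE.
by congr (tnth _ _ _); exact: coord_var.
Qed.

Lemma meval_mmap (n : nat) (h : 'I_n -> {mpoly R[9]}) (q : {mpoly R[n]}) v :
  (mmap C h q).@[v] = q.@[fun i => (h i).@[v]].
Proof. by rewrite (rmorph_mmap _ _ (meval v)); apply: eq_mmap => // c; exact: mevalC. Qed.

Lemma mpoly_coord_inj (p q : {mpoly R[9]}) :
  (forall H : H4 R, p.@[fun i => coord H i] = q.@[fun i => coord H i]) -> p = q.
Proof.
move=> pq; apply/eqP; rewrite -subr_eq0; apply/eqP; apply: mpoly_vanish => v.
have vE (r : {mpoly R[9]}) : r.@[v] =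
    r.@[fun i => coord (of_coords (fun k => v (inord k))) i].
  by apply: meval_eq => i; rewrite coord_of_coords // inord_val.
by rewrite mevalB !vE pq subrr.
Qed.

Lemma power_product_invariant m :
  homogeneous_invariant (weighted_degree m) (power_product R m).
Proof.
split; first exact: power_product_homog.
move=> g H; rewrite /coord_eval /power_product /mmap1 !rmorph_prod.
apply: eq_bigr => k _; rewrite !rmorphXn /= !generator_eval.
by rewrite octavic_invariant.
Qed.

Lemma mmap_power_product (q : {mpoly R[9]}) :
  mmap C (@generator R) q = \sum_(m <- msupp q) q@_m *: power_product R m.
Proof. by apply: eq_bigr => m _; rewrite mul_mpolyC. Qed.

(** Otherwise [P] together with the standard products of degree [d] would give one more independent
    invariant than [count_standard d] allows. *)
Lemma homogeneous_spanned d P : homogeneous_invariant d P ->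
  exists q, P = mmap C (@generator R) q.
Proof.
move=> invP; apply: boolp.contrapT => notspan.
pose s := standard_mnms d; pose n := size s.
pose G (i : 'I_(1 + n)) : {mpoly R[9]} :=
  if split i is inr j then power_product R (nth 0%MM s j) else P.
have stds : all standard s by apply/allP => m /standard_mnmsP[].
have Ginv i : homogeneous_invariant d (G i).
  rewrite /G; case: split => // j.
  have /standard_mnmsP[_ <-] : nth 0%MM s j \in s by rewrite mem_nth.
  exact: power_product_invariant.
have : independent G.
  move=> c; rewrite big_split_ord /= big_ord1.
  have -> : G (lshift n ord0) = P by rewrite /G (unsplitK (inl ord0 : 'I_1 + 'I_n)).
  under eq_bigr => j _ do rewrite /G (unsplitK (inr j : 'I_1 + 'I_n)).
  move=> c0; have [z|nz] := eqVneq (c (lshift n ord0)) 0.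
    move=> i; case: (split_ordP i) => j ->; first by rewrite ord1.
    rewrite z scale0r add0r in c0.
    exact: (standard_independent (uniq_standard_mnms d) stds (c := fun j => c
      (rshift 1 j)) c0).
  case: notspan; exists (- (c (lshift n ord0))^-1 *:
     \sum_(j < n) c (rshift 1 j) *: 'X_[nth 0%MM s j]).
  rewrite mmapZ mul_mpolyC (_ : mmap _ _ _ =
    \sum_(j < n) c (rshift 1 j) *: power_product R (nth 0%MM s j)); last first.
    by rewrite raddf_sum; apply: eq_bigr => j _; rewrite /= mmapZ mmapX mul_mpolyC.
  move/eqP: c0; rewrite addr_eq0 => /eqP c0.
  rewrite -[LHS](scalerK nz) c0 scalerN scaleNr; congr (- (_ *: _)).
move/(invariant_bound Ginv); rewrite -size_standard_mnms -/s -/n; lia.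
Qed.

(** Homogeneous components of an invariant are invariant, because the action commutes with scaling
    the tensor. *)
Lemma invariant_spanned (F : {mpoly R[9]}) : O3_invariant (coord_eval F) ->
  exists q, F = mmap C (@generator R) q.
Proof.
move=> invF; pose D := msize F.
have FE : F = \sum_(d < D) pihomog mdeg d F by apply: pihomog_partitionE.
have inv d : homogeneous_invariant d (pihomog mdeg d F).
  split; first exact: pihomogP.
  move=> g H; case: (ltnP d D) => [dD|Dd]; last first.
    rewrite /coord_eval (_ : pihomog mdeg d F = 0) ?meval0 //.
    rewrite pihomogE big_seq_cond big1 // => m /andP[mF /eqP md].
    by have := msize_mdeg_lt mF; rewrite md ltnNge Dd.
  (* The values of the components are the coefficients of [t |-> F (t H)], a polynomial function of
     [t] that the action leaves unchanged. *)
  pose pol (H : H4 R) : {poly R} := \poly_(e < D) coord_eval (pihomog mdeg e F) H.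
  suff : pol (actH g H) = pol H by move/(congr1 (fun p : {poly R} => p`_d));
    rewrite !coef_poly dD.
  have polE H' t : (pol H').[t] = F.@[fun i => t * coord H' i].
    rewrite horner_poly [in RHS]FE raddf_sum; apply: eq_bigr => e _ /=.
    by rewrite (dhomog_evalZ _ _ (pihomogP _ _ _)) mulrC.
  apply/eqP; rewrite -subr_eq0; apply/eqP; apply: poly_vanish => t.
  apply/eqP; rewrite hornerD hornerN subr_eq0 !polE; apply/eqP.
  have tE : (fun i : 'I_9 => t * coord (actH g H) i) =1
      (fun i : 'I_9 => coord (actH g (of_coords (fun k => t * coord H k))) i).
    move=> i; rewrite /coord /= !ffunE mulr_sumr; apply: eq_bigr => u _.
    rewrite mulrCA; congr (_ * _); rewrite tensor_coordsZ.
    by congr (_ * _); rewrite -{1}(of_coordsK H).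
  rewrite (meval_eq F tE) -[LHS]/(coord_eval F (actH g _)) invF.
  by apply: meval_eq => i; rewrite coord_of_coords.
have /fin_all_exists[q qE] : forall d : 'I_D, exists q,
    pihomog mdeg d F = mmap C (@generator R) q.
  by move=> d; apply: homogeneous_spanned (inv d).
exists (\sum_d q d); rewrite raddf_sum {1}FE; apply: eq_bigr => d _; exact: qE.
Qed.

Lemma octavic_generate f : invariant_polynomial f ->
  exists q : {mpoly R[9]}, forall H, f H = q.@[fun i => tnth (octavic R) i H].
Proof.
move=> [[p pE] inv_f].
(* Pull [p] back from the 81 components to the nine coordinates. *)
pose h (a : 'I_#|{: 4.-tuple 'I_3}|) := component (ring_arith {mpoly R[9]}) (var R)
  (mult_idx 1 (enum_val a)) (mult_idx 2 (enum_val a)).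
pose F := mmap C h p.
have FE H : F.@[fun i => coord H i] = f H.
  rewrite meval_mmap pE; apply: meval_eq => a; rewrite -{2}(coord_var H) /= ffunE /h.
  by rewrite /component; case: (mult_idx 2 _) => [|[|[|[|?]]]] /=;
    rewrite ?mevalN ?mevalD.
have [|q qE] := @invariant_spanned F.
  by move=> g H; rewrite /coord_eval !FE.
exists q => H; rewrite -FE qE meval_mmap; apply: meval_eq => k.
exact: generator_eval.
Qed.

(** A relation among the generators has no linear term: its part of weighted degree [i + 2], at most
    10, involves only standard monomials, whose products are independent. *)
Lemma generator_independent (Q : {mpoly R[9]}) (i : 'I_9) :
  mmap C (@generator R) Q = 0 -> Q@_U_(i) = 0.
Proof.
move=> Q0; pose s := [seq m <- msupp Q | weighted_degree m == (i + 2)%N].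
have stds : all standard s.
  apply/allP => m; rewrite mem_filter => /andP[/eqP mi _]; apply: standard_of_degree.
  by rewrite mi; have := ltn_ord i; lia.
have us : uniq s by apply: filter_uniq; exact: msupp_uniq.
have s0 : \sum_(j < size s) Q@_(nth 0%MM s j) *: power_product R (nth 0%MM s j) = 0.
  rewrite -(big_mkord xpredT (fun j => Q@_(nth 0%MM s j) *: power_product R
    (nth 0%MM s j))).
  rewrite -(big_nth 0%MM xpredT (fun m => Q@_m *: power_product R m)) big_filter.
  have := congr1 (pihomog mdeg (i + 2)) Q0.
  rewrite mmap_power_product raddf_sum raddf0 (bigID (fun m => weighted_degree m
    == (i + 2)%N)) /=.
  rewrite [X in _ + X]big1 ?addr0 => [E|m mi].
    rewrite -[RHS]E; apply: eq_bigr => m /eqP mi; rewrite linearZ /= pihomog_dE // -mi.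
    exact: power_product_homog.
  by rewrite linearZ /= (pihomog_ne0 mi (power_product_homog R m)) scaler0.
have coefs := standard_independent us stds s0.
have wi : weighted_degree U_(i) = (i + 2)%N.
  rewrite /weighted_degree (bigD1 i) //= mnm1E eqxx muln1 big1 ?addn0 // => j /negPf ji.
  by rewrite mnm1E eq_sym ji muln0.
apply/eqP; rewrite mcoeff_eq0; apply/negP => iQ.
have is_ : U_(i)%MM \in s by rewrite mem_filter wi eqxx.
have jlt : (index U_(i)%MM s < size s)%N by rewrite index_mem.
have := coefs (Ordinal jlt); rewrite /= nth_index // => /eqP.
by rewrite mcoeff_eq0 iQ.
Qed.

(** Writing a missing generator [i] as a polynomial in the others would give a relation in which
    ['X_i] has coefficient 1. *)
Lemma octavic_minimal (J : {set 'I_9}) : J \proper [set: 'I_9] ->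
  ~ integrity_basis (fun a : 'I_#|J| => tnth (octavic R) (enum_val a)).
Proof.
move=> /properP[_ [i _ iJ]] [_ gen].
have [q qE] := gen _ (conj (octavic_polynomial R i) (@octavic_invariant R i)).
pose h (a : 'I_#|J|) : {mpoly R[9]} := 'X_(enum_val a).
pose Q := 'X_i - mmap C h q.
have Q0 : mmap C (@generator R) Q = 0.
  rewrite mmapB mmapX mmap1U; apply/eqP; rewrite subr_eq0; apply/eqP.
  apply: mpoly_coord_inj => H; rewrite generator_eval qE !meval_mmap.
  apply: meval_eq => a; rewrite -meval_mmap /h mmapX mmap1U generator_eval //.
(* The substituted [q] does not involve ['X_i], so the derivative of [Q] is 1; its constant term is
   the coefficient of ['X_i] in [Q]. *)
have dQ : Q^`M(i) = 1.
  have lE (p : {mpoly R[9]}) : p^`M(i) = lder (fun j => (j == i)%:R) p.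
    rewrite lderE (bigD1 i) //= eqxx mul1r big1 ?addr0 // => j /negPf ->.
    by rewrite mul0r.
  rewrite mderivB mderivXU eqxx [X in _ - X]lE lder_mmap big1 ?subr0 // => a _.
  rewrite lderX; case: eqP => [ai|_]; last by rewrite mulr0.
  by have := enum_valP a; rewrite ai (negPf iJ).
have := congr1 (mcoeff 0%MM) dQ; rewrite mcoeff_mderiv add0m.
rewrite (generator_independent i Q0) mul0rn mcoeff1 eqxx => /eqP.
by rewrite eq_sym oner_eq0.
Qed.

End Generation.

Theorem theorem2p8 (R : realType) :
  minimal_integrity_basis
    (tnth [tuple @I2 R; @I3 R; @I4 R; @I5 R; @I6 R; @I7 R; @I8 R; @I9 R; @I10 R]).
Proof.
split; last by move=> J JT; exact: octavic_minimal.
split=> [k|f inv_f]; last exact: octavic_generate.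
by split; [exact: octavic_polynomial | exact: octavic_invariant].
Qed.
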